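(* Let $d\ge 2$, let $\gamma=(\gamma_2,\dots,\gamma_d)$ be a $(d-1)$-tuple of cone-like restriction functions (CRF), let $\beta_2,\dots,\beta_d\ge 1$ be fixed, let $L$ be the associated cone-like set, and let $\alpha=(\alpha_1,\dots,\alpha_d)$ with $\alpha_i>0$ for $i=1,\dots,d$. Then the maximal operator $\sigma_L^{\kappa,\alpha,*}$ is of type $(p,p)$ for every $1<p\le\infty$ and of weak type $(1,1)$. That is: for every $1<p\le\infty$ there is a constant $C_p$ such that $\|\sigma_L^{\kappa,\alpha,*}f\|_p\le C_p\|f\|_p$ for all $f\in L_p(G^d)$; and there is a constant $C$ such that $$\sup_{\lambda>0}\lambda\,\mu\big(\{x\in G^d:\sigma_L^{\kappa,\alpha,*}f(x)>\lambda\}\big)\le C\|f\|_1\qquad\text{for all } f\in L_1(G^d).$$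
   Context: $\mathbb{N}=\{0,1,2,\dots\}$. $G=\prod_{k=0}^\infty \mathbb{Z}_2$ is the Walsh group: elements are sequences $x=(x_0,x_1,\dots)$ with $x_k\in\{0,1\}$, coordinatewise addition mod 2, product topology, and $\mu$ is the normalized Haar measure (product of the measures giving mass $1/2$ to $0$ and $1$). On $G^d$ the product measure is also denoted $\mu$; points are $x=(x^1,\dots,x^d)$. Walsh-Kaczmarz system: $r_k(x)=(-1)^{x_k}$. Write $n\in\mathbb{N}$ as $n=\sum_i n_i2^i$ with $n_i\in\{0,1\}$, and for $n\ge1$ let $|n|=\max\{j:n_j\ne0\}$. Set $\kappa_0=1$ and for $n\ge 1$, $\kappa_n(x)=r_{|n|}(x)\prod_{k=0}^{|n|-1}(r_{|n|-1-k}(x))^{n_k}$. For $n\in\mathbb{N}^d$, $\kappa_n(x)=\kappa_{n_1}(x^1)\cdots\kappa_{n_d}(x^d)$. Cone-like restriction functions: $\gamma_j:[1,\infty)\to[1,\infty)$ ($j=2,\dots,d$) are CRF if they are strictly increasing and continuous, $\lim_{+\infty}\gamma_j=+\infty$, $\gamma_j(1)=1$, and there exist $\zeta,c_{j,1},c_{j,2}>1$ such that $c_{j,1}\gamma_j(x)\le\gamma_j(\zeta x)\le c_{j,2}\gamma_j(x)$ for all $x\ge1$. The cone-like set is $$L=\{n\in\mathbb{N}^d:\ n_1\ge 1,\ \beta_j^{-1}\gamma_j(n_1)\le n_j\le\beta_j\gamma_j(n_1),\ j=2,\dots,d\}.$$ Fourier coefficients and Cesàro means: for $f\in L^1(G^d)$,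 $\widehat f^\kappa(k)=\int_{G^d}f\kappa_k\,d\mu$. The rectangular partial sums are $S_k^\kappa(f;x)=\sum_{i_1=0}^{k_1-1}\cdots\sum_{i_d=0}^{k_d-1}\widehat f^\kappa(i)\kappa_i(x)$ (zero if some $k_j=0$). With $A_j^{a}=\binom{j+a}{j}=\frac{(a+1)(a+2)\cdots(a+j)}{j!}$ ($A_0^a=1$), the $(C,\alpha)$ means are $$\sigma_n^{\kappa,\alpha}f(x)=\frac{1}{\prod_{i=1}^dA_{n_i}^{\alpha_i}}\sum_{k_1=0}^{n_1}\cdots\sum_{k_d=0}^{n_d}\Big(\prod_{i=1}^dA_{n_i-k_i}^{\alpha_i-1}\Big)S_k^\kappa(f;x),$$ and $\sigma_L^{\kappa,\alpha,*}f(x)=\sup_{n\in L}|\sigma_n^{\kappa,\alpha}f(x)|$. *)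

(* Defs.v *)
From HB Require Import structures.
From mathcomp Require Import all_boot all_order all_algebra.
From mathcomp Require Import all_classical all_reals all_analysis.
From mathcomp Require Import lra.

Set Implicit Arguments.
Unset Strict Implicit.
Unset Printing Implicit Defensive.

Import Order.TTheory GRing.Theory Num.Def Num.Theory.
Import numFieldNormedType.Exports.

Local Open Scope classical_set_scope.
Local Open Scope ring_scope.

(* The Walsh group is the product of countably many copies of Z/2, i.e. bool
   with exclusive or, under the product topology; it carries its Borel
   sigma-algebra. *)
Definition walsh_group := g_sigma_algebraType (@open cantor_space).

(* The elementary cylinder prescribing the first n coordinates; these sets form
   a countable base of the topology and generate the Borel sigma-algebra. *)
Definition dyadic_interval (n : nat) (a : nat -> bool) : set walsh_group :=
  [set x : cantor_space | forall k, (k < n)%N -> x k = a k].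

Lemma open_dyadic_interval n a : @open cantor_space (dyadic_interval n a).
Proof.
have -> : dyadic_interval n a =
    \bigcap_(k in `I_n) ((@proj nat (fun=> bool) k) @^-1` [set a k]).
  by apply/seteqP; split => x xI k kn; exact: xI.
elim: n => [|n IHn]; first by rewrite II0 bigcap_set0; exact: openT.
rewrite IIS bigcap_setU bigcap_set1; apply: openI => //.
apply: open_comp => [x _|]; first exact: proj_continuous.
exact: discrete_open.
Qed.

Lemma measurable_dyadic_interval n a : measurable (dyadic_interval n a).
Proof. by apply: sub_sigma_algebra; exact: open_dyadic_interval. Qed.

Lemma dyadic_interval_eq n a b : (forall k, (k < n)%N -> a k = b k) ->
  dyadic_interval n a = dyadic_interval n b.
Proof.
by move=> ab; apply/seteqP; split => x xI k kn; rewrite xI // ab.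
Qed.

Lemma dyadic_intervalI n m a b : (n <= m)%N ->
  dyadic_interval n a `&` dyadic_interval m b = set0 \/
  dyadic_interval n a `&` dyadic_interval m b = dyadic_interval m b.
Proof.
move=> nm; have [ab|nab] := pselect (forall k, (k < n)%N -> a k = b k).
  right; apply/seteqP; split => [x []//|x xb]; split => // k kn.
  by rewrite ab // xb // (leq_trans kn).
left; rewrite -subset0 => x [xa xb]; apply: nab => k kn.
by rewrite -xa // xb // (leq_trans kn).
Qed.

Lemma nbhs_dyadic_interval (x : cantor_space) (A : set cantor_space) :
  nbhs x A -> exists n, dyadic_interval n x `<=` A.
Proof.
pose F := filter_from [set: nat] (fun n => (dyadic_interval n x : set cantor_space)).
have FF : Filter F.
  apply: filter_from_filter; first by exists 0%N.
  move=> i j _ _; exists (maxn i j) => // y yij; split => k ki; apply: yij.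
    by rewrite (leq_trans ki) // leq_maxl.
  by rewrite (leq_trans ki) // leq_maxr.
suff /[apply] : F --> x by case=> n _ xA; exists n.
apply/cvg_sup => k B /= [C [[D oD <-] /= Dx] CB].
by exists k.+1 => // y yx; apply: CB; rewrite /= yx.
Qed.

Lemma walsh_group_measurableE :
  @measurable _ walsh_group = <<s [set dyadic_interval na.1 na.2 | na in setT] >>.
Proof.
apply/seteqP; split; last first.
  apply: smallest_sub; first exact: sigma_algebra_measurable.
  by move=> _ [[n a] _ <-]; exact: measurable_dyadic_interval.
apply: smallest_sub; first exact: smallest_sigma_algebra.
move=> A oA; pose I (s : seq bool) := dyadic_interval (size s) (nth false s).
set M := [set _ | _ in _].
have -> : A = \bigcup_s (if `[< I s `<=` A >] then I s else set0).
  apply/seteqP; split => [x Ax|x [s _]]; last by case: asboolP => // sA /sA.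
  have [n nA] := nbhs_dyadic_interval (open_nbhs_nbhs (conj oA Ax)).
  have E : I (mkseq x n) = dyadic_interval n x.
    rewrite /I size_mkseq; apply: dyadic_interval_eq => k kn.
    by rewrite nth_mkseq.
  exists (mkseq x n) => //; case: asboolP => [_|]; last by rewrite E.
  by rewrite E.
apply: (@countable_bigcupT_measurable _ (g_sigma_algebraType M)) => // s.
case: asboolP => _; last exact: measurable0.
by apply: sub_sigma_algebra; exists (size s, nth false s).
Qed.

(* Existence of the product of countably many fair coins: the image of Lebesgue
   measure on [0, 1[ under the sequence of binary digits. *)
Section haar_existence.
Variable R : realType.

Let digits (t : R) : walsh_group :=
  (fun k => (0 <= t < 1) && odd (truncn (2 ^+ k.+1 * t))) : cantor_space.

Let code (a : nat -> bool) := fix code n :=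
  if n is m.+1 then (a m + (code m).*2)%N else 0%N.

Let digitsP n a t : 0 <= t < 1 ->
  dyadic_interval n a (digits t) <-> truncn (2 ^+ n * t) = code a n.
Proof.
move=> t01; have /andP[t0 t1] := t01.
have x0 m : 0 <= 2 ^+ m * t by rewrite mulr_ge0 // exprn_ge0.
have half m : (truncn (2 ^+ m.+1 * t))./2 = truncn (2 ^+ m * t).
  apply/esym/eqP; rewrite truncn_eq //.
  have /andP[] := truncn_itv (x0 m.+1); set u := truncn _.
  rewrite -[u in u%:R <= _]odd_double_half -[u in _ < u.+1%:R]odd_double_half.
  rewrite exprS -mulrA; set x := 2 ^+ m * t.
  have : ((odd u)%:R : R) <= 1 by case: odd.
  have : 0 <= ((odd u)%:R : R) by [].
  rewrite -!natr1 !natrD -!muln2 !natrM => *; apply/andP; split; lra.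
elim: n => [|n IHn].
  by split => // _; rewrite expr0 mul1r; apply/eqP; rewrite truncn_eq.
rewrite /= -(odd_double_half (truncn _)) half; split => [tI|E].
  have -> : truncn (2 ^+ n * t) = code a n.
    by apply/IHn => k kn; apply: tI; rewrite ltnS ltnW.
  by rewrite -(tI n) // /digits t01.
have oE : odd (truncn (2 ^+ n.+1 * t)) = a n.
  by have /(congr1 odd) := E; rewrite !oddD !odd_double !addbF !oddb.
have /IHn tI : truncn (2 ^+ n * t) = code a n.
  by move: E; rewrite oE => /addnI /double_inj.
move=> k; rewrite ltnS leq_eqVlt => /predU1P[->|/tI //].
by rewrite /digits t01.
Qed.

Let code_lt a n : (code a n < 2 ^ n)%N.
Proof.
elim: n => //= n IHn; rewrite expnS mul2n -[X in (X <= _)%N]addnS.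
apply: (@leq_trans (1 + (code a n).*2.+1)%N); first by rewrite leq_add2r leq_b1.
by rewrite add1n -doubleS leq_double.
Qed.

Let dyadic_itv a n : set R :=
  `[(code a n)%:R / 2 ^+ n, (code a n).+1%:R / 2 ^+ n[%classic.

Let dyadic_itvP a n t : dyadic_itv a n t <->
  (0 <= t < 1) /\ dyadic_interval n a (digits t).
Proof.
have p2 : 0 < 2 ^+ n :> R by rewrite exprn_gt0.
have tE : dyadic_itv a n t <->
    ((code a n)%:R <= 2 ^+ n * t < (code a n).+1%:R).
  by rewrite /dyadic_itv /= in_itv /= ler_pdivrMr // ltr_pdivlMr // mulrC.
split => [/tE/andP[l r]|[t01 /(digitsP _ _ t01)/eqP]]; last first.
  rewrite truncn_eq; first by move/tE.
  by case/andP: t01 => ? _; rewrite mulr_ge0 // ltW.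
have t01 : 0 <= t < 1.
  apply/andP; split.
    by rewrite -(pmulr_rge0 _ p2) (le_trans _ l).
  rewrite -(ltr_pM2l p2) mulr1 (lt_le_trans r) //.
  by rewrite -natrX ler_nat code_lt.
split => //; apply/(digitsP _ _ t01)/eqP; rewrite truncn_eq ?l ?r //.
by rewrite (le_trans _ l).
Qed.

Let measurable_digits : measurable_fun [set: R] digits.
Proof.
have := @measurability _ _ _ _ setT digits _ walsh_group_measurableE.
apply=> _ [_ [[n a] _ <-] <-]; rewrite setTI /=.
rewrite (_ : _ @^-1` _ = dyadic_itv a n `|`
    (~` `[0, 1[%classic `&` [set _ | dyadic_interval n a (fun=> false)])).
  apply: measurableU; first exact: measurable_itv.
  apply: measurableI; first by apply: measurableC; exact: measurable_itv.
  have [F|nF] := pselect (dyadic_interval n a (fun=> false)).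
    by rewrite (_ : [set _ | _] = setT) //; apply/seteqP; split.
  by rewrite (_ : [set _ | _] = set0) //; apply/seteqP; split.
have out t : ~ (0 <= t < 1) -> digits t = (fun=> false).
  by move=> /negP/negbTE t01; apply/funext => k; rewrite /digits t01.
apply/seteqP; split => t /=; rewrite in_itv /=.
  have [t01|t01] := pselect (0 <= t < 1); first by left; apply/dyadic_itvP.
  by right; rewrite -(out t).
by case=> [/dyadic_itvP[]//|[t01]]; rewrite -(out t).
Qed.

Let unit_itv : measurable (`[0, 1[%classic : set R) := measurable_itv `[0, 1[.

Let coin : set walsh_group -> \bar R :=
  pushforward (mrestr lebesgue_measure unit_itv) digits.

Let coin0 : coin set0 = 0%E.
Proof. by rewrite /coin /pushforward preimage_set0 measure0. Qed.

Let coin_ge0 A : (0 <= coin A)%E. Proof. exact: measure_ge0. Qed.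

Let coin_sigma_additive : semi_sigma_additive coin.
Proof.
move=> F mF tF mUF; rewrite /coin /pushforward preimage_bigcup.
apply: measure_semi_sigma_additive.
- by move=> n; rewrite -[X in measurable X]setTI; exact: measurable_digits.
- apply/trivIsetP => /= i j _ _ ij; rewrite -preimage_setI.
  by move/trivIsetP : tF => /(_ _ _ _ _ ij) ->//; rewrite preimage_set0.
- by rewrite -preimage_bigcup -[X in measurable X]setTI; exact: measurable_digits.
Qed.

HB.instance Definition _ := isMeasure.Build _ _ _ coin
  coin0 coin_ge0 coin_sigma_additive.

Let coin_dyadic n a : coin (dyadic_interval n a) = (\prod_(k < n) 2^-1)%:E.
Proof.
rewrite /coin /pushforward /mrestr.
rewrite (_ : _ `&` _ = dyadic_itv a n); last first.
  apply/seteqP; split => t /=; rewrite in_itv /=.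
    by case=> tI t01; apply/dyadic_itvP.
  by move=> /dyadic_itvP[].
have p2 : 0 < 2 ^+ n :> R by rewrite exprn_gt0.
rewrite /dyadic_itv lebesgue_measure_itv /= lte_fin ltr_pM2r ?invr_gt0 //.
rewrite ltr_nat ltnSn -EFinB -mulrBl -natr1 addrAC subrr add0r mul1r.
by rewrite prodr_const card_ord exprVn.
Qed.

Let coinT : coin setT = 1%E.
Proof.
rewrite (_ : setT = dyadic_interval 0 (fun=> false)); last first.
  by apply/seteqP; split.
by rewrite coin_dyadic big_ord0.
Qed.

HB.instance Definition _ := Measure_isProbability.Build _ _ _ coin coinT.

Lemma haar_exists : exists P : probability walsh_group R,
  forall n a, P (dyadic_interval n a) = (\prod_(k < n) 2^-1)%:E.
Proof. by exists coin; exact: coin_dyadic. Qed.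

End haar_existence.

(* The product of the measures of mass 1/2 on each point of bool. It is
   determined by its values on cylinders (haar_unique), and it is the normalized
   Haar measure (haar_translation_invariant). *)
Definition haar (R : realType) : probability walsh_group R :=
  projT1 (cid (haar_exists R)).

Section haar_properties.
Variable R : realType.

Lemma haar_dyadic_interval n a :
  haar R (dyadic_interval n a) = (\prod_(k < n) 2^-1)%:E.
Proof. exact: (projT2 (cid (haar_exists R))). Qed.

Lemma haar_unique (P : {measure set walsh_group -> \bar R}) :
  (forall n a, P (dyadic_interval n a) = (\prod_(k < n) 2^-1)%:E) ->
  forall A, measurable A -> P A = haar R A.
Proof.
move=> PE; pose I0 := dyadic_interval 0 (fun=> false).
pose G := [set A | A = set0 \/ exists n a, A = dyadic_interval n a].
have IT : I0 = setT by apply/seteqP; split.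
apply: (measure_unique G (fun=> I0)).
- rewrite walsh_group_measurableE; apply/seteqP; split.
    apply: smallest_sub; first exact: smallest_sigma_algebra.
    move=> _ [[n a] _ <-]; apply: sub_sigma_algebra; right.
    by exists n, a.
  rewrite -walsh_group_measurableE; apply: smallest_sub.
    exact: sigma_algebra_measurable.
  by move=> _ [->|[n [a ->]]] //; exact: measurable_dyadic_interval.
- move=> _ _ [->|[n [a ->]]] [->|[m [b ->]]]; rewrite ?set0I ?setI0; try by left.
  have [nm|/ltnW mn] := leqP n m.
    have [->|->] := dyadic_intervalI a b nm; first by left.
    by right; exists m, b.
  rewrite setIC; have [->|->] := dyadic_intervalI b a mn; first by left.
  by right; exists n, a.
- by move=> _; right; exists 0%N, (fun=> false).
- by rewrite bigcup_const //; exists 0%N.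
- move=> _ [->|[n [a ->]]]; first by rewrite !measure0.
  by rewrite PE; exact/esym/haar_dyadic_interval.
- by move=> _; rewrite PE ltry.
Qed.

Definition walsh_translate (a x : walsh_group) : walsh_group :=
  (fun k => (x : cantor_space) k (+) (a : cantor_space) k) : cantor_space.

Lemma walsh_translate_dyadic n (a : walsh_group) b :
  walsh_translate a @^-1` dyadic_interval n b =
  dyadic_interval n (walsh_translate a b).
Proof.
apply/seteqP; split => x xI k /xI; rewrite /walsh_translate.
  by move=> <-; rewrite addbK.
by move=> ->; rewrite addbK.
Qed.

Lemma measurable_walsh_translate a :
  measurable_fun [set: walsh_group] (walsh_translate a).
Proof.
have := @measurability _ _ _ _ setT (walsh_translate a) _ walsh_group_measurableE.
apply=> _ [_ [[n b] _ <-] <-].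
rewrite setTI walsh_translate_dyadic; exact: measurable_dyadic_interval.
Qed.

Lemma haar_translation_invariant a A : measurable A ->
  haar R (walsh_translate a @^-1` A) = haar R A.
Proof.
move=> mA; pose t := mfun_Sub (mem_set (measurable_walsh_translate a)).
apply: (@haar_unique (distribution (haar R) t)) => // n b.
transitivity (haar R (walsh_translate a @^-1` dyadic_interval n b)) => //.
rewrite walsh_translate_dyadic.
exact: haar_dyadic_interval.
Qed.

End haar_properties.

Lemma product_exists d (T : measurableType d) (R : realType)
    (P : probability T R) (n : nat) :
  exists Q : probability (n.-tuple T) R,
    forall A : 'I_n -> set T, (forall i, measurable (A i)) ->
    Q [set x | forall i, A i (tnth x i)] = (\prod_(i < n) P (A i))%E.
Proof.
elim: n => [|n [Q QE]].
  exists (dirac [tuple]) => A mA; rewrite big_ord0 /= diracE.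
  by rewrite mem_set // => -[].
have mc : measurable_fun [set: T * n.-tuple T]
    (fun x => [the n.+1.-tuple T of x.1 :: x.2]).
  by apply: measurable_cons => //; exact: measurable_snd.
pose c := mfun_Sub (mem_set mc).
exists (distribution (P \x Q)%E c) => A mA.
rewrite /distribution /pushforward big_ord_recl -QE; last by move=> i.
rewrite -product_measure1E //; last first.
  rewrite (_ : [set x | _] = \bigcap_(i in [set: 'I_n])
      ((@tnth n T ^~ i) @^-1` A (lift ord0 i))); last first.
    by apply/seteqP; split => [x xA i _|x xA i]; exact: xA.
  apply: fin_bigcap_measurable => // i _.
  by rewrite -[X in measurable X]setTI; exact: measurable_tnth.
congr ((P \x Q)%E _); apply/seteqP; split => -[x y] /=.
  move=> xyA; split; first by have := xyA ord0.
  by move=> i; have := xyA (lift ord0 i); rewrite tnthS.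
move=> [xA yA] i; have [j ->|->] := unliftP ord0 i; last exact: xA.
by rewrite tnthS.
Qed.

(* The n-fold product of P with itself on n-tuples, which the library provides
   only for pairs. *)
Definition product_probability d (T : measurableType d) (R : realType)
    (P : probability T R) (n : nat) : probability (n.-tuple T) R :=
  projT1 (cid (product_exists P n)).

Lemma product_probabilityE d (T : measurableType d) (R : realType)
    (P : probability T R) (n : nat) (A : 'I_n -> set T) :
  (forall i, measurable (A i)) ->
  product_probability P n [set x | forall i, A i (tnth x i)] =
  (\prod_(i < n) P (A i))%E.
Proof. exact: (projT2 (cid (product_exists P n))). Qed.

Definition haar_prod (R : realType) (D : nat) :
    probability (D.-tuple walsh_group) R :=
  product_probability (haar R) D.

Definition binary_digit (n k : nat) : bool := odd (n %/ 2 ^ k).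

(* |n|, the largest j with n_j != 0; such a j satisfies j < 2 ^ j <= n. *)
Definition binary_order (n : nat) : nat :=
  (\max_(j < n | binary_digit n j) j)%N.

Section kaczmarz_system.
Variable R : realType.

Definition rademacher (k : nat) (x : walsh_group) : R :=
  (-1) ^+ ((x : cantor_space) k).

Definition kaczmarz (n : nat) (x : walsh_group) : R :=
  if n == 0%N then 1 else
  rademacher (binary_order n) x *
  \prod_(k < binary_order n)
    rademacher (binary_order n - 1 - k) x ^+ binary_digit n k.

Variable D : nat.
Implicit Types (n k : 'I_D -> nat) (f : D.-tuple walsh_group -> R)
  (x : D.-tuple walsh_group).

Definition kaczmarz_prod n x : R := \prod_(j < D) kaczmarz (n j) (tnth x j).

Definition kaczmarz_coef f k : R :=
  \int[haar_prod R D]_x (f x * kaczmarz_prod k x).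

(* The sum over the i in N^D with i_j < k_j for all j; it is empty as soon as
   some k_j = 0. *)
Definition kaczmarz_partial_sum k f x : R :=
  \sum_(i : {dffun forall j : 'I_D, 'I_(k j)})
    kaczmarz_coef f (fun j => i j) * kaczmarz_prod (fun j => i j) x.

Definition cesaro_number (a : R) (j : nat) : R :=
  (\prod_(1 <= i < j.+1) (a + i%:R)) / j`!%:R.

Definition cesaro_mean (alpha : 'I_D -> R) n f x : R :=
  (\prod_(i < D) cesaro_number (alpha i) (n i))^-1 *
  \sum_(k : {dffun forall i : 'I_D, 'I_(n i).+1})
    (\prod_(i < D) cesaro_number (alpha i - 1) (n i - k i)) *
    kaczmarz_partial_sum (fun i => k i) f x.

Definition maximal_cesaro_mean (L : set ('I_D -> nat)) (alpha : 'I_D -> R)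
    f x : \bar R :=
  ereal_sup [set `|cesaro_mean alpha n f x|%:E | n in L].

End kaczmarz_system.

(* In dimension d + 1 the first coordinate has index ord0, and the index j : 'I_d
   of gamma and beta corresponds to the coordinate lift ord0 j. The functions
   gamma j matter on [1, +oo[ only. *)
Definition cone_restriction_functions (R : realType) (d : nat)
    (gamma : 'I_d -> R -> R) : Prop :=
  [/\ forall j x, 1 <= x -> 1 <= gamma j x,
      forall j, {in `[1, +oo[ &, {homo gamma j : x y / x < y}},
      forall j, {within `[1, +oo[, continuous (gamma j)},
      forall j, gamma j x @[x --> +oo] --> +oo
    & (forall j, gamma j 1 = 1) /\
      exists2 zeta : R, 1 < zeta & forall j, exists c1 c2 : R,
        [/\ 1 < c1, 1 < c2 & forall x, 1 <= x ->
          c1 * gamma j x <= gamma j (zeta * x) <= c2 * gamma j x] ].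

Definition cone_like_set (R : realType) (d : nat) (gamma : 'I_d -> R -> R)
    (beta : 'I_d -> R) : set ('I_d.+1 -> nat) :=
  [set n | (1 <= n ord0)%N /\ forall j : 'I_d,
    (beta j)^-1 * gamma j (n ord0)%:R <= (n (lift ord0 j))%:R
      <= beta j * gamma j (n ord0)%:R].

(* Main.v *)
Require Import Defs.
From mathcomp Require Import all_boot all_order all_algebra.
From mathcomp Require Import all_classical all_reals all_analysis.
From mathcomp Require Import measurable_realfun ess_sup_inf.
From mathcomp Require Import zify ring lra.

(** The proof dominates every Cesaro kernel by averages over sets of a very simple
    shape, and controls the maximal function of these averages by a stopping time.

    In one variable the numerator of the kernel of order [n] is the sum over [i < n]
    of [A (n - 1 - i) * kappa_i (x)], with [A] the Cesaro numbers of order [a]. On a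
    dyadic block [2 ^ N <= i < 2 ^ N.+1] the functions [kappa_i] are Walsh functions
    of the first [N] coordinates read backwards, so the block is the value of a
    product of operators [1 + S ^ (2 ^ k)] and [1 - S ^ (2 ^ k)] applied to [A], one
    for each coordinate, with [S] the shift. A coordinate equal to 1 gives a
    difference. Two of them, the last two ones of [x] below [N], say at [p] and at
    [t - 1] with [t <= p] (and [t = 0] if there is only one), suffice: the differences
    of [A] are Cesaro numbers of order [a - 1], which are monotone, so that a further
    difference is controlled by its total variation ([kaczmarz_block_le]). The blocks
    up to the first nonzero coordinate of [x] are not small, but their sum telescopes.
    The outcome ([cesaro_kernel_bound]) is that the kernels of order at most [2 ^ M]
    are dominated by a superposition, with weights geometric in [m], [t] and [p], of
    normalized indicators of boxes: the sets of [z] whose coordinates of index [k],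
    [t <= k < M - m], are those of the unit vector at [p].

    In several variables the kernel is a product, so for fixed [m], [t], [p] one has
    to average [|f|] over products of boxes. Along the cone all sides are determined
    by the first coordinate of the index, and they decrease when it grows
    ([cone_level_ndecr]). Hence the averages are conditional expectations on an
    increasing family of finite partitions, composed with a translation, and stopping
    at the first large average gives a weak type (1,1) inequality with constant one
    ([nested_kernel_weak_type]). The geometric weights make it possible to sum
    over all boxes ([majorant_weak_type]).

    Cutting [f] at a multiple of [lambda] turns this into a bound of the measure of the set where
    the maximal function exceeds [lambda] by [1 / lambda] times the integral of [|f|]
    over the set where [|f|] exceeds a fixed multiple of [lambda]
    ([maximal_distribution]). This contains the weak type inequality, the case of
    bounded functions and, after summation over dyadic levels, all the cases between
    them ([distribution_Lp]). *)

Set Implicit Arguments.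
Unset Strict Implicit.
Unset Printing Implicit Defensive.

Import Order.TTheory GRing.Theory Num.Theory.
Import numFieldNormedType.Exports.

Local Open Scope classical_set_scope.
Local Open Scope ring_scope.

(** * Cesaro numbers *)

Section cesaro_numbers.
Variable R : realType.
Implicit Types (a : R) (k n : nat) (m : int).

Lemma cesaro_number0 a : cesaro_number a 0 = 1.
Proof. by rewrite /cesaro_number big_geq// fact0 divr1. Qed.

Lemma cesaro_numberS a k :
  cesaro_number a k.+1 = cesaro_number a k * ((a + k.+1%:R) / k.+1%:R).
Proof.
rewrite /cesaro_number big_nat_recr//= factS natrM invfM.
by rewrite [X in _ * X = _]mulrC mulrACA.
Qed.

Lemma cesaro_number_shift a k :
  cesaro_number (a - 1) k * (a + k%:R) = cesaro_number a k * a.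
Proof.
elim: k => [|k IH]; first by rewrite !cesaro_number0 addr0.
rewrite !cesaro_numberS.
have -> : a - 1 + k.+1%:R = a + k%:R by rewrite -natr1; ring.
by rewrite mulrA IH -!mulrA; congr (_ * _); ring.
Qed.

Lemma cesaro_number_pascal a k :
  cesaro_number a k.+1 = cesaro_number a k + cesaro_number (a - 1) k.+1.
Proof.
rewrite !cesaro_numberS.
have -> : a - 1 + k.+1%:R = a + k%:R by rewrite -natr1; ring.
rewrite [in RHS]mulrA cesaro_number_shift.
rewrite -[in RHS]mulrA -[X in _ = X + _]mulr1 -mulrDr; congr (_ * _).
by rewrite mulrDl divff ?pnatr_eq0// addrC.
Qed.

Lemma cesaro_number_gt0 a k : -1 < a -> 0 < cesaro_number a k.
Proof.
move=> a1; elim: k => [|k IH]; first by rewrite cesaro_number0.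
rewrite cesaro_numberS mulr_gt0// divr_gt0//.
have := ler0n R k; rewrite -natr1; lra.
Qed.

(** Each of the [k] factors [1 + a / i], [k < i <= 2 * k], is at least
    [1 + a / (2 * k)]. Together with the converse inequality below this is polynomial
    growth, read on powers of two. *)
Lemma cesaro_number_double_ge a k : 0 <= a -> (0 < k)%N ->
  (1 + a / 2) * cesaro_number a k <= cesaro_number a k.*2.
Proof.
move=> a0 k0.
have A0 j : 0 < cesaro_number a j.
  by apply: cesaro_number_gt0; rewrite (lt_le_trans _ a0)// ltrN10.
suff H j : (j <= k)%N ->
    (1 + a * j%:R / (k.*2)%:R) * cesaro_number a k <= cesaro_number a (k + j).
  have := H k (leqnn _); rewrite addnn; apply: le_trans.
  rewrite ler_pM2r// lerD2l -mulrA ler_wpM2l//.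
  rewrite -muln2 natrM invfM mulrA divff ?mul1r//.
  by rewrite pnatr_eq0 -lt0n.
elim: j => [|j IH] jk; first by rewrite mulr0 mul0r addr0 mul1r addn0.
rewrite addnS cesaro_numberS.
apply: (@le_trans _ _ (cesaro_number a (k + j) * (1 + a / (k.*2)%:R))); last first.
  rewrite ler_pM2l// mulrDl addrC divff ?pnatr_eq0// lerD2r ler_wpM2l//.
  by rewrite lef_pV2 ?posrE ?ltr0n ?double_gt0// ler_nat; lia.
have {}IH := IH (ltnW jk).
apply: le_trans (_ : _ <= ((1 + a * j%:R / (k.*2)%:R) * cesaro_number a k) *
   (1 + a / (k.*2)%:R)) _; last first.
  by rewrite ler_wpM2r// addr_ge0// divr_ge0.
have -> : a * j.+1%:R / k.*2%:R = a * j%:R / k.*2%:R + a / k.*2%:R.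
  by rewrite -natr1 mulrDr mulr1 mulrDl.
set u := a * j%:R / _; set v := a / _; rewrite -subr_ge0.
have -> : (1 + u) * cesaro_number a k * (1 + v) - (1 + (u + v)) * cesaro_number a k
   = cesaro_number a k * (u * v) by ring.
apply: mulr_ge0; first exact: ltW.
by apply: mulr_ge0; rewrite divr_ge0 ?mulr_ge0.
Qed.

Lemma cesaro_number_double_le a k : 0 <= a ->
  cesaro_number a k.*2 <= expR a * cesaro_number a k.
Proof.
move=> a0; have [->|k0] := posnP k.
  by rewrite cesaro_number0 mulr1 (le_trans _ (expR_ge1Dx a))// lerDl.
have A0 j : 0 < cesaro_number a j.
  by apply: cesaro_number_gt0; rewrite (lt_le_trans _ a0)// ltrN10.
suff H j : cesaro_number a (k + j) <= expR (a * j%:R / k%:R) * cesaro_number a k.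
  by have := H k; rewrite addnn -mulrA divff ?mulr1// pnatr_eq0 -lt0n.
elim: j => [|j IH]; first by rewrite mulr0 mul0r expR0 mul1r addn0.
have -> : a * j.+1%:R / k%:R = a * j%:R / k%:R + a / k%:R.
  by rewrite -natr1 mulrDr mulr1 mulrDl.
rewrite addnS cesaro_numberS expRD.
rewrite [leRHS]mulrAC; apply: ler_pM => //; first exact: ltW.
  by rewrite divr_ge0// addr_ge0.
rewrite (le_trans _ (expR_ge1Dx _))// mulrDl addrC divff ?pnatr_eq0//.
rewrite lerD2l ler_wpM2l// lef_pV2 ?posrE ?ltr0n ?ler_nat//; lia.
Qed.

Lemma cesaro_number_ndecr a k n : 0 <= a -> (k <= n)%N ->
  cesaro_number a k <= cesaro_number a n.
Proof.
move=> a0; elim: n => [|n IH]; first by rewrite leqn0 => /eqP ->.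
rewrite leq_eqVlt => /predU1P[->//|]; rewrite ltnS => /IH /le_trans; apply.
rewrite cesaro_number_pascal lerDl cesaro_numberS mulr_ge0//.
  case: n {IH} => [|n]; first by rewrite cesaro_number0.
  have -> : cesaro_number (a - 1) n.+1 = cesaro_number a n.+1 * a / (a + n.+1%:R).
    by rewrite -cesaro_number_shift mulfK// gt_eqF// ltr_wpDl.
  rewrite divr_ge0 ?addr_ge0// mulr_ge0//.
  by rewrite ltW// cesaro_number_gt0// (lt_le_trans _ a0)// ltrN10.
by rewrite divr_ge0// -natr1 addrACA addNr addr0 addr_ge0.
Qed.

End cesaro_numbers.

(** * Windows of the sequence of Cesaro numbers *)

Section cesaro_windows.
Variable R : realType.
Implicit Types (a : R) (k n h H q M : nat) (m p : int).

(** Extending by zero to the negative integers makes backward differences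
    exact, without boundary terms. *)
Definition cesaro_ext a m : R := if m is Posz k then cesaro_number a k else 0.

Lemma cesaro_ext_lt0 a m : m < 0 -> cesaro_ext a m = 0.
Proof. by case: m. Qed.

Lemma cesaro_extB a m : cesaro_ext a m - cesaro_ext a (m - 1) = cesaro_ext (a - 1) m.
Proof.
case: m => [[|k]|k]; first by rewrite /= subr0 !cesaro_number0.
- have -> : k.+1%:Z - 1 = k%:Z by lia.
  by rewrite /= cesaro_number_pascal addrC addKr.
- by rewrite cesaro_ext_lt0 ?subr0//; lia.
Qed.

Lemma cesaro_ext_ge0 a m : -1 < a -> 0 <= cesaro_ext a m.
Proof. by move=> a1; case: m => //= k; rewrite ltW// cesaro_number_gt0. Qed.

Lemma cesaro_ext_ndecr a m p : 0 <= a -> m <= p -> cesaro_ext a m <= cesaro_ext a p.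
Proof.
move=> a0; have a1 : -1 < a by rewrite (lt_le_trans _ a0)// ltrN10.
case: m => [k|k] mp; last by rewrite cesaro_ext_ge0.
by case: p mp => // n; rewrite lez_nat => kn; exact: cesaro_number_ndecr.
Qed.

Lemma cesaro_ext_nincr a m p : 0 < a <= 1 -> 0 <= m <= p ->
  cesaro_ext (a - 1) p <= cesaro_ext (a - 1) m.
Proof.
case/andP => a0 a1 /andP[]; case: m p => // k [n|]//= _.
rewrite lez_nat; elim: n => [|n IH]; first by rewrite leqn0 => /eqP ->.
rewrite leq_eqVlt => /predU1P[->//|]; rewrite ltnS => /IH; apply: le_trans.
rewrite cesaro_numberS ler_piMr//.
  by apply/ltW/cesaro_number_gt0; rewrite -[X in X < _]add0r ltrD2r.
by rewrite ler_pdivrMr// mul1r -natr1; lra.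
Qed.

Lemma window_cesaro_ext a h p :
  \sum_(j < h) cesaro_ext (a - 1) (p - j%:Z) = cesaro_ext a p - cesaro_ext a (p - h%:Z).
Proof.
elim: h => [|h IH]; first by rewrite big_ord0 subr0 subrr.
rewrite big_ord_recr/= IH -cesaro_extB.
have -> : p - h%:Z - 1 = p - h.+1%:Z by lia.
ring.
Qed.

(** The factor by which the sum of [b = cesaro_ext (a - 1)] over a window decreases
    when the window is halved. For [a <= 1] it comes from the growth of the Cesaro
    numbers, for [a >= 1] one half would do. *)
Definition cesaro_ratio a : R := (1 + Num.min a 1 / 2)^-1.

Lemma cesaro_ratio_itv a : 0 < a -> 2^-1 <= cesaro_ratio a < 1.
Proof.
move=> a0; have m0 : 0 < Num.min a 1 by rewrite lt_min a0 ltr01.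
have m1 : Num.min a 1 <= 1 by rewrite ge_min lexx orbT.
rewrite /cesaro_ratio lef_pV2 ?posrE//; last by lra.
by rewrite invf_lt1; lra.
Qed.

Lemma cesaro_ratio_gt0 a : 0 < a -> 0 < cesaro_ratio a.
Proof.
by move=> /cesaro_ratio_itv/andP[+ _]; apply: lt_le_trans; rewrite invr_gt0.
Qed.

Lemma cesaro_number_pow2 a q M : 0 < a <= 1 -> (q <= M)%N ->
  cesaro_number a (2 ^ q) <= cesaro_ratio a ^+ (M - q) * cesaro_number a (2 ^ M).
Proof.
case/andP => a0 a1 qM; rewrite -{2}(subnKC qM).
elim: (M - q)%N => [|r IH]; first by rewrite addn0 mul1r.
apply: (le_trans IH); rewrite exprSr -mulrA ler_wpM2l//.
  by rewrite exprn_ge0// ltW// cesaro_ratio_gt0.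
rewrite /cesaro_ratio (min_idPl a1) mulrC ler_pdivlMr; last by lra.
by rewrite mulrC addnS expnS mul2n cesaro_number_double_ge ?expn_gt0// ltW.
Qed.

(** For [a <= 1] the sequence [b] decreases, so the window of length [2 ^ q] at the
    origin has the largest sum; for [a >= 1] it increases, and its value at [2 ^ M] is
    [a / (a + 2 ^ M)] times the Cesaro number of order [a]. *)
Lemma window_cesaro_le a q M p : 0 < a -> (q <= M)%N -> p <= (2 ^ M)%N%:Z ->
  cesaro_ext a p - cesaro_ext a (p - (2 ^ q)%N%:Z) <=
    (1 + a) * (cesaro_ratio a ^+ (M - q) * cesaro_number a (2 ^ M)).
Proof.
move=> a0 qM pM; have a1 : -1 < a by rewrite (lt_le_trans (ltrN10 _))// ltW.
have AM : 0 < cesaro_number a (2 ^ M) by exact: cesaro_number_gt0.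
have r0 := cesaro_ratio_gt0 a0.
have S0 : 0 <= cesaro_ratio a ^+ (M - q) * cesaro_number a (2 ^ M).
  by rewrite mulr_ge0// ltW// exprn_gt0.
have [a_le1|/ltW a_ge1] := leP a 1.
  have aa : 0 < a <= 1 by rewrite a0.
  apply: (@le_trans _ _ (cesaro_ratio a ^+ (M - q) * cesaro_number a (2 ^ M))); last first.
    by rewrite ler_peMl// lerDl ltW.
  apply: le_trans (cesaro_number_pow2 aa qM).
  case: p {pM} => [k|k]; last first.
    rewrite !cesaro_ext_lt0; [|lia|lia].
    by rewrite subr0; exact/ltW/cesaro_number_gt0.
  elim: k => [|k IH].
    rewrite [X in _ - X]cesaro_ext_lt0; last by have := expn_gt0 2 q; lia.
    by rewrite subr0 /= cesaro_number_ndecr// ltW.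
  have [kq|qk] := ltnP k.+1 (2 ^ q).
    rewrite [X in _ - X]cesaro_ext_lt0 ?subr0; last by lia.
    by rewrite /= cesaro_number_ndecr ?(ltW a0) ?(ltnW kq).
  apply: le_trans IH.
  have H1 := cesaro_extB a k.+1%:Z; have H2 := cesaro_extB a (k.+1%:Z - (2 ^ q)%N%:Z).
  have E1 : k.+1%:Z - 1 = k%:Z by lia.
  have E2 : k.+1%:Z - (2 ^ q)%N%:Z - 1 = k%:Z - (2 ^ q)%N%:Z by lia.
  rewrite E1 in H1; rewrite E2 in H2.
  have : cesaro_ext (a - 1) k.+1%:Z <= cesaro_ext (a - 1) (k.+1%:Z - (2 ^ q)%N%:Z).
    by apply: cesaro_ext_nincr => //; lia.
  rewrite -H1 -H2; lra.
rewrite -window_cesaro_ext.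
have B j : cesaro_ext (a - 1) (p - j%:Z) <= cesaro_number a (2 ^ M) * a / (2 ^ M)%:R.
  apply: (@le_trans _ _ (cesaro_ext (a - 1) (2 ^ M)%N%:Z)).
    by apply: cesaro_ext_ndecr; [rewrite subr_ge0|lia].
  have P0 : 0 < (2 ^ M)%:R :> R by rewrite ltr0n expn_gt0.
  rewrite /= ler_pdivlMr// -cesaro_number_shift ler_wpM2l ?lerDr ?(ltW a0)//.
  by rewrite ltW// cesaro_number_gt0// ltrBrDr addNr.
apply: (@le_trans _ _ ((2 ^ q)%:R * (cesaro_number a (2 ^ M) * a / (2 ^ M)%:R))).
  by rewrite mulr_natl -[X in _ *+ X]card_ord -sumr_const; apply: ler_sum.
have -> : (2 ^ q)%:R * (cesaro_number a (2 ^ M) * a / (2 ^ M)%:R) =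
    a * ((2^-1) ^+ (M - q) * cesaro_number a (2 ^ M)) :> R.
  rewrite -{2}(subnKC qM) expnD natrM invfM !natrX exprVn.
  have : (2 ^+ q : R) != 0 by rewrite expf_neq0.
  have : (2 ^+ (M - q) : R) != 0 by rewrite expf_neq0.
  by move=> ? ?; field; apply/andP.
have /andP[r1 _] := cesaro_ratio_itv a0.
apply: ler_pM => //; [exact: ltW| |by rewrite lerDr|].
  by rewrite mulr_ge0 ?(ltW AM)// exprn_ge0.
by rewrite ler_wpM2r ?(ltW AM)// lerXn2r// nnegrE// ltW.
Qed.

(** The increment [b (m) - b (m - h)] of the monotone sequence [b] has constant
    sign, except for [m < h] when [b] decreases; up to that initial segment its
    total variation telescopes. *)
Lemma variation_cesaro_le a q M p H : 0 < a -> (q <= M)%N -> p <= (2 ^ M)%N%:Z ->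
  \sum_(j < H) `|cesaro_ext (a - 1) (p - j%:Z)
                 - cesaro_ext (a - 1) (p - j%:Z - (2 ^ q)%N%:Z)| <=
    3 * (1 + a) * (cesaro_ratio a ^+ (M - q) * cesaro_number a (2 ^ M)).
Proof.
move=> a0 qM pM; have a1 : -1 < a by rewrite (lt_le_trans (ltrN10 _))// ltW.
set S := _ * cesaro_number a (2 ^ M); set h := (2 ^ q)%N.
have r0 := cesaro_ratio_gt0 a0.
have S0 : 0 <= S by rewrite mulr_ge0// ltW ?exprn_gt0// cesaro_number_gt0.
have W p' : p' <= (2 ^ M)%N%:Z -> cesaro_ext a p' - cesaro_ext a (p' - h%:Z) <= (1 + a) * S.
  by move=> ?; apply: window_cesaro_le.
have c0 p' : 0 <= cesaro_ext a p' - cesaro_ext a (p' - h%:Z).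
  by rewrite subr_ge0 cesaro_ext_ndecr//; [exact: ltW|lia].
have T : \sum_(j < H) (cesaro_ext (a - 1) (p - j%:Z)
      - cesaro_ext (a - 1) (p - j%:Z - h%:Z)) =
   (cesaro_ext a p - cesaro_ext a (p - h%:Z)) -
   (cesaro_ext a (p - H%:Z) - cesaro_ext a (p - H%:Z - h%:Z)).
  rewrite sumrB window_cesaro_ext.
  under [X in _ - X]eq_bigr do rewrite addrAC.
  by rewrite window_cesaro_ext [p - h%:Z - _]addrAC; ring.
have [a_le1|/ltW a_ge1] := leP a 1; last first.
  rewrite (eq_bigr (fun j : 'I_H => cesaro_ext (a - 1) (p - j%:Z)
      - cesaro_ext (a - 1) (p - j%:Z - h%:Z))) => [|j _]; last first.
    by rewrite ger0_norm// subr_ge0 cesaro_ext_ndecr//; [rewrite subr_ge0|lia].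
  rewrite T; have := W _ pM; have := c0 (p - H%:Z).
  have : 0 <= (1 + a) * S by rewrite mulr_ge0// addr_ge0// ltW.
  lra.
have aa : 0 < a <= 1 by rewrite a0.
have b0 m : 0 <= cesaro_ext (a - 1) m.
  by apply: cesaro_ext_ge0; rewrite ltrBrDr addNr.
(* the values of [cesaro_ext a] stopped at the index [h - 1], whose increments are
   the terms of the initial segment *)
pose c' m := cesaro_ext a (Num.min m (h%:Z - 1)).
have c'B m : c' m - c' (m - 1) = if m < h%:Z then cesaro_ext (a - 1) m else 0.
  rewrite /c'; case: ltP => mh.
    rewrite (min_idPl _); last by lia.
    by rewrite (min_idPl _) ?cesaro_extB//; lia.
  rewrite (min_idPr _); last by lia.
  by rewrite (min_idPr _) ?subrr//; lia.
apply: (@le_trans _ _ (\sum_(j < H) ((cesaro_ext (a - 1) (p - j%:Z - h%:Z)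
      - cesaro_ext (a - 1) (p - j%:Z)) + 2 * (c' (p - j%:Z) - c' (p - j%:Z - 1))))).
  apply: ler_sum => j _; rewrite c'B; set m := p - j%:Z.
  case: ltP => mh.
    rewrite [cesaro_ext _ (m - _)]cesaro_ext_lt0; last by lia.
    by rewrite subr0 ger0_norm//; have := b0 m; lra.
  rewrite mulr0 addr0 ler0_norm; first by lra.
  by rewrite subr_le0 cesaro_ext_nincr//; lia.
rewrite big_split/= -mulr_sumr.
have -> : \sum_(j < H) (c' (p - j%:Z) - c' (p - j%:Z - 1)) = c' p - c' (p - H%:Z).
  elim: H {T} => [|H IH]; first by rewrite big_ord0 subr0 subrr.
  rewrite big_ord_recr/= IH; have -> : p - H%:Z - 1 = p - H.+1%:Z by lia.
  ring.
have -> : \sum_(j < H) (cesaro_ext (a - 1) (p - j%:Z - h%:Z)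
      - cesaro_ext (a - 1) (p - j%:Z)) =
   (cesaro_ext a (p - H%:Z) - cesaro_ext a (p - H%:Z - h%:Z)) -
   (cesaro_ext a p - cesaro_ext a (p - h%:Z)).
  by rewrite -[RHS]opprB -T -sumrN; apply: eq_bigr => j _; rewrite opprB.
have c'1 : c' p <= (1 + a) * S.
  apply: (@le_trans _ _ S); last by rewrite ler_peMl// lerDl ltW.
  apply: le_trans (cesaro_number_pow2 aa qM).
  rewrite -/(cesaro_ext a (2 ^ q)%N%:Z) /c' cesaro_ext_ndecr//; first exact: ltW.
  rewrite ge_min -/h; lia.
have c'0 : 0 <= c' (p - H%:Z) by apply: cesaro_ext_ge0.
have := W (p - H%:Z); have := c0 p.
have pH : p - H%:Z <= (2 ^ M)%N%:Z by lia.
move=> ? /(_ pH); lra.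
Qed.

End cesaro_windows.

(** * Walsh sums as products of sums and differences *)

Section dyadic_transform.
Variable R : realType.
Implicit Types (e : nat -> R) (s i q h : nat) (c : int -> R) (m : int).

(** The value at [m] of the product over [k < s] of the operators
    [1 + e k * S ^ (2 ^ k)] applied to [c], with [S] the backward shift. For signs
    [e k] this is a Walsh sum of length [2 ^ s]; a factor with [e k = 0] is absent. *)
Fixpoint dyadic_transform e s c m : R :=
  if s is s'.+1 then
    dyadic_transform e s' c m + e s' * dyadic_transform e s' c (m - (2 ^ s')%N%:Z)
  else c m.

Lemma eq_dyadic_transform e e' s c m : (forall k, (k < s)%N -> e k = e' k) ->
  dyadic_transform e s c m = dyadic_transform e' s c m.
Proof.
elim: s m => //= s IH m ee'.
have ee k : (k < s)%N -> e k = e' k by move=> ks; rewrite ee'// ltnW.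
by rewrite !IH// ee'.
Qed.

Lemma dyadic_transform_shift e s c h m :
  dyadic_transform e s (fun m => c (m - h%:Z)) m = dyadic_transform e s c (m - h%:Z).
Proof. by elim: s m => //= s IH m; rewrite !IH addrAC. Qed.

Lemma dyadic_transformB e s c c' m :
  dyadic_transform e s (fun m => c m - c' m) m =
  dyadic_transform e s c m - dyadic_transform e s c' m.
Proof. by elim: s m => //= s IH m; rewrite !IH; ring. Qed.

Lemma dyadic_transform_sum e s h (c : 'I_h -> int -> R) m :
  dyadic_transform e s (fun m => \sum_(j < h) c j m) m =
  \sum_(j < h) dyadic_transform e s (c j) m.
Proof. by elim: s m => //= s IH m; rewrite !IH mulr_sumr big_split. Qed.

Lemma sum_pow2_recr s (F : nat -> R) :
  \sum_(j < 2 ^ s.+1) F j = \sum_(j < 2 ^ s) F j + \sum_(j < 2 ^ s) F (2 ^ s + j)%N.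
Proof. by rewrite expnS mul2n -addnn big_split_ord. Qed.

Lemma dyadic_transform_norm_le e s c m : (forall k, `|e k| <= 1) ->
  `|dyadic_transform e s c m| <= \sum_(j < 2 ^ s) `|c (m - j%:Z)|.
Proof.
move=> e1; elim: s m => [|s IH] m /=; first by rewrite big_ord1 subr0.
rewrite (sum_pow2_recr _ (fun j => `|c (m - j%:Z)|)).
apply: (le_trans (ler_normD _ _)); apply: lerD => //.
rewrite normrM; apply: le_trans (ler_piMl _ (e1 _)) _ => //.
apply: (le_trans (IH _)); rewrite le_eqVlt; apply/orP; left; apply/eqP.
by apply: eq_bigr => j _; congr (`|c _|); lia.
Qed.

Lemma dyadic_transform1 s c m :
  dyadic_transform (fun=> 1) s c m = \sum_(j < 2 ^ s) c (m - j%:Z).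
Proof.
elim: s m => [|s IH] m /=; first by rewrite big_ord1 subr0.
rewrite (sum_pow2_recr _ (fun j => c (m - j%:Z))) !IH mul1r; congr (_ + _).
by apply: eq_bigr => j _; congr (c _); lia.
Qed.

(** The operators commute, so a difference [1 - S ^ (2 ^ i)] can be applied to the
    sequence first. *)
Lemma dyadic_transformD1 e s i c m : (i < s)%N -> e i = -1 ->
  dyadic_transform e s c m =
  dyadic_transform (fun k => if k == i then 0 else e k) s
    (fun m => c m - c (m - (2 ^ i)%N%:Z)) m.
Proof.
move=> lis ei; rewrite dyadic_transformB dyadic_transform_shift.
elim: s lis m => //= s IH; rewrite ltnS leq_eqVlt => /predU1P[si|si] m; last first.
  rewrite gtn_eqF// !IH//; rewrite [_ - _ - (2 ^ i)%N%:Z]addrAC; ring.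
rewrite -si eqxx !mul0r !addr0 ei mulN1r.
by congr (_ - _); apply: eq_dyadic_transform => k ki; rewrite ltn_eqF.
Qed.

Variables (a : R) (M : nat).
Hypothesis a0 : 0 < a.
Let A := cesaro_number a (2 ^ M).
Let kap := cesaro_ratio a.

(** A difference with step [2 ^ i] of the Cesaro numbers of order [a] is a sum of
    [2 ^ i] Cesaro numbers of order [a - 1]. *)
Lemma dyadic_transform_cesaroD1 e s i m : (i < s)%N -> e i = -1 ->
  `|dyadic_transform e s (cesaro_ext a) m| <=
  \sum_(j < 2 ^ i) `|dyadic_transform (fun k => if k == i then 0 else e k) s
                       (cesaro_ext (a - 1)) (m - j%:Z)|.
Proof.
move=> lis ei; rewrite (dyadic_transformD1 _ _ lis ei).
have -> : (fun m => cesaro_ext a m - cesaro_ext a (m - (2 ^ i)%N%:Z)) =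
    (fun m => \sum_(j < 2 ^ i) cesaro_ext (a - 1) (m - j%:Z)).
  by apply/funext => k; rewrite window_cesaro_ext.
rewrite (dyadic_transform_sum _ _ (fun (j : 'I_(2 ^ i)) m => cesaro_ext (a - 1) (m - j%:Z))).
apply: le_trans (ler_norm_sum _ _ _) _; apply: ler_sum => j _.
by rewrite (dyadic_transform_shift _ _ (cesaro_ext (a - 1))).
Qed.

Lemma dyadic_transform_cesaro_le1 e s i m : (forall k, `|e k| <= 1) ->
  (i < s <= M)%N -> m <= (2 ^ M)%N%:Z -> e i = -1 ->
  `|dyadic_transform e s (cesaro_ext a) m| <=
    2 ^+ i * ((1 + a) * (kap ^+ (M - s) * A)).
Proof.
move=> e1 /andP[lis sM] mM ei; apply: le_trans (dyadic_transform_cesaroD1 _ lis ei) _.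
rewrite -natrX mulr_natl -[X in _ *+ X]card_ord -sumr_const; apply: ler_sum => j _.
apply: le_trans (dyadic_transform_norm_le _ _ _ _) _.
  by move=> k; case: eqP => // _; rewrite normr0.
under eq_bigr do rewrite ger0_norm ?cesaro_ext_ge0 ?ltrBrDr ?addNr//.
by rewrite window_cesaro_ext; apply: window_cesaro_le => //; lia.
Qed.

(** The second difference, with step [2 ^ q], acts on a monotone sequence, so only
    windows of length [2 ^ q] remain, instead of [2 ^ s]. *)
Lemma dyadic_transform_cesaro_le2 e s i q m : (forall k, `|e k| <= 1) ->
  (i < s <= M)%N -> (q < s)%N -> q != i -> m <= (2 ^ M)%N%:Z ->
  e i = -1 -> e q = -1 ->
  `|dyadic_transform e s (cesaro_ext a) m| <=
    2 ^+ i * (3 * (1 + a) * (kap ^+ (M - q) * A)).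
Proof.
move=> e1 /andP[lis sM] qs qi mM ei eqq; apply: le_trans (dyadic_transform_cesaroD1 _ lis ei) _.
rewrite -natrX mulr_natl -[X in _ *+ X]card_ord -sumr_const; apply: ler_sum => j _.
rewrite (@dyadic_transformD1 _ _ q)// ?(negbTE qi)//.
apply: le_trans (dyadic_transform_norm_le _ _ _ _) _.
  by move=> k; case: eqP => [|_]; [rewrite normr0|case: eqP => // _; rewrite normr0].
by apply: variation_cesaro_le => //; lia.
Qed.

End dyadic_transform.

Section kaczmarz_blocks.
Variable R : realType.
Implicit Types (x : walsh_group) (c : int -> R) (N K : nat) (m : int).

Lemma binary_digitD N l k : (k < N)%N -> binary_digit (2 ^ N + l) k = binary_digit l k.
Proof.
move=> kN; rewrite /binary_digit -(subnK (ltnW kN)) expnD divnMDl ?expn_gt0//.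
by rewrite oddD oddX subn_eq0 leqNgt kN.
Qed.

Lemma binary_digit_lead N l : (l < 2 ^ N)%N -> binary_digit (2 ^ N + l) N.
Proof. by move=> lN; rewrite /binary_digit -[X in (X + l)%N]mul1n divnMDl ?expn_gt0// divn_small. Qed.

Lemma binary_digit_small l k : (l < 2 ^ k)%N -> binary_digit l k = false.
Proof. by move=> lk; rewrite /binary_digit divn_small. Qed.

Lemma binary_orderD N l : (l < 2 ^ N)%N -> binary_order (2 ^ N + l) = N.
Proof.
move=> lN; have Nn : (N < 2 ^ N + l)%N by rewrite ltn_addr// ltn_expl.
apply/eqP; rewrite eqn_leq; apply/andP; split; last first.
  exact: (@leq_bigmax_cond _ _ (@nat_of_ord _) (Ordinal Nn) (binary_digit_lead lN)).
apply/bigmax_leqP => j /=; apply: contraTT; rewrite -ltnNge => Nj.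
rewrite binary_digit_small// (@leq_trans (2 ^ N.+1))//.
  by rewrite expnS mul2n -addnn ltn_add2l.
by rewrite leq_exp2l.
Qed.

Lemma kaczmarzD N l x : (l < 2 ^ N)%N ->
  kaczmarz R (2 ^ N + l) x = rademacher R N x *
    \prod_(k < N) rademacher R (N - 1 - k) x ^+ binary_digit l k.
Proof.
move=> lN; rewrite /kaczmarz binary_orderD// gtn_eqF ?addn_gt0 ?expn_gt0//.
by congr (_ * _); apply: eq_bigr => k _; rewrite binary_digitD.
Qed.

Lemma walsh_sumE (e : nat -> R) s c m :
  \sum_(l < 2 ^ s) c (m - l%:Z) * \prod_(k < s) e k ^+ binary_digit l k =
  dyadic_transform e s c m.
Proof.
elim: s m => [|s IH] m; first by rewrite big_ord1 subr0 big_ord0 mulr1.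
rewrite (sum_pow2_recr _ (fun l => c (m - l%:Z) * \prod_(k < s.+1) e k ^+ binary_digit l k)).
rewrite /= -!IH mulr_sumr; congr (_ + _); apply: eq_bigr => l _.
  by rewrite big_ord_recr/= binary_digit_small// mulr1.
rewrite big_ord_recr/= binary_digit_lead// expr1 mulrA mulrC; congr (_ * (c _ * _)).
  by lia.
by apply: eq_bigr => k _; rewrite binary_digitD.
Qed.

(** The Walsh-Kaczmarz functions of one dyadic block are the Walsh functions of
    the point whose first [N] coordinates are read backwards. *)
Definition reversed_signs x N (k : nat) : R := rademacher R (N - 1 - k) x.

Lemma kaczmarz_sum_recr c m x M :
  \sum_(i < 2 ^ M.+1) c (m - i%:Z) * kaczmarz R i x =
  \sum_(i < 2 ^ M) c (m - i%:Z) * kaczmarz R i x +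
  rademacher R M x * dyadic_transform (reversed_signs x M) M c (m - (2 ^ M)%N%:Z).
Proof.
rewrite (sum_pow2_recr _ (fun i => c (m - i%:Z) * kaczmarz R i x)); congr (_ + _).
rewrite -walsh_sumE mulr_sumr; apply: eq_bigr => l _.
by rewrite kaczmarzD// mulrCA; congr (_ * (c _ * _)); lia.
Qed.

Lemma kaczmarz_sum_blocks c m x K M : (K <= M)%N ->
  \sum_(i < 2 ^ M) c (m - i%:Z) * kaczmarz R i x =
  \sum_(i < 2 ^ K) c (m - i%:Z) * kaczmarz R i x +
  \sum_(K <= N < M) rademacher R N x *
    dyadic_transform (reversed_signs x N) N c (m - (2 ^ N)%N%:Z).
Proof.
elim: M => [|M IH]; first by rewrite leqn0 => /eqP ->; rewrite big_geq// addr0.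
rewrite leq_eqVlt => /predU1P[->|]; first by rewrite [X in _ + X]big_geq// addr0.
by rewrite ltnS => KM; rewrite kaczmarz_sum_recr IH// big_nat_recr//= addrA.
Qed.

Lemma reversed_signs1 x N K k : (forall j, (j < K)%N -> x j = false) ->
  (N <= K)%N -> (k < N)%N -> reversed_signs x N k = 1.
Proof. by move=> x0 NK kN; rewrite /reversed_signs /rademacher x0//; lia. Qed.

Lemma reversed_signs_norm x N k : `|reversed_signs x N k| <= 1.
Proof. by rewrite /reversed_signs /rademacher normrX normrN1 expr1n. Qed.

Lemma kaczmarz_sum_zero c m x K : (forall j, (j < K)%N -> x j = false) ->
  \sum_(i < 2 ^ K) c (m - i%:Z) * kaczmarz R i x = \sum_(i < 2 ^ K) c (m - i%:Z).
Proof.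
elim: K => [|K IH] x0; first by rewrite !big_ord1 /kaczmarz mulr1.
rewrite kaczmarz_sum_recr IH; last by move=> j jK; rewrite x0// ltnW.
rewrite (sum_pow2_recr _ (fun i => c (m - i%:Z))); congr (_ + _).
rewrite /rademacher x0// mul1r.
rewrite (@eq_dyadic_transform _ _ (fun=> 1)) => [|k kK]; last first.
  exact: (reversed_signs1 x0).
by rewrite dyadic_transform1; apply: eq_bigr => j _; congr (c _); lia.
Qed.

End kaczmarz_blocks.

(** * One dyadic block of the kernel *)

(** For [t <= N] this is a cylinder of measure [2 ^ (t - N)] on which the first [t]
    coordinates are free; it is a translate of the one whose prescribed coordinates
    all vanish. *)
Definition dyadic_box (N t p : nat) : set walsh_group :=
  [set z : cantor_space | forall k, (t <= k < N)%N -> z k = (k == p)].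

Definition box_kernel (R : realType) (N t p : nat) (z : walsh_group) : R :=
  2 ^+ (N - t) * \1_(dyadic_box N t p) z.

Section kaczmarz_kernel.
Variable R : realType.
Implicit Types (x z : walsh_group) (N K M t p : nat) (m : int).

Lemma box_kernel_ge0 N t p z : 0 <= box_kernel R N t p z.
Proof. by rewrite mulr_ge0// exprn_ge0. Qed.

Lemma box_kernelE N t p z : dyadic_box N t p z -> box_kernel R N t p z = 2 ^+ (N - t).
Proof. by move=> zb; rewrite /box_kernel indicE mem_set// mulr1. Qed.

Lemma last_true (x : nat -> bool) N k : (k < N)%N -> x k ->
  exists2 p, (k <= p < N)%N & x p /\ forall j, (p < j < N)%N -> x j = false.
Proof.
elim: N k => // N IH k; rewrite ltnS => kN xk.
have [xN|xN] := boolP (x N).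
  by exists N; [rewrite kN ltnS leqnn|split=> // j /andP[? ?]; lia].
have kN' : (k < N)%N.
  by rewrite ltn_neqAle kN andbT; apply: contraNneq xN => <-.
have [p /andP[kp pN] [xp pj]] := IH _ kN' xk.
exists p; first by rewrite kp ltnW.
split=> // j /andP[pj']; rewrite ltnS leq_eqVlt => /predU1P[->|jN].
  exact: negbTE.
by apply: pj; rewrite pj'.
Qed.

Variables (a : R) (M : nat).
Hypothesis a0 : 0 < a.
Let A := cesaro_number a (2 ^ M).
Let kap := cesaro_ratio a.

Let A0 : 0 < A.
Proof. by apply: cesaro_number_gt0; rewrite (lt_trans (ltrN10 _)). Qed.

Let pow2_le (r s : nat) : 2 ^+ r <= 2 ^+ (r + s) * kap ^+ s.
Proof.
have /andP[k2 _] := cesaro_ratio_itv a0.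
rewrite exprD -mulrA ler_peMr// -exprMn exprn_ege1//.
by rewrite -ler_pdivrMl// mulr1.
Qed.

(** Read backwards, the last and the next to last nonzero coordinates of [x] below
    [N] are the first two differences among the factors of the transform. *)
Lemma kaczmarz_block_le x N k m : (k < N <= M)%N -> x k -> m <= (2 ^ M)%N%:Z ->
  exists t p, [/\ (t <= p < N)%N, dyadic_box N t p x &
    `|dyadic_transform (reversed_signs R x N) N (cesaro_ext a) m| <=
      3 * (1 + a) * A * (kap ^+ (M - N + p) * 2 ^+ (N - t))].
Proof.
move=> /andP[kN NM] xk mM.
have [p /andP[kp pN] [xp px]] := last_true kN xk.
have sg j : (j < N)%N -> x j -> reversed_signs R x N (N - 1 - j) = -1.
  move=> jN xj; rewrite /reversed_signs /rademacher.
  have -> : (N - 1 - (N - 1 - j) = j)%N by lia.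
  by rewrite xj expr1.
have k0 : 0 <= kap by apply/ltW/cesaro_ratio_gt0.
have A0' := ltW A0.
have Q0 j : 0 <= kap ^+ j * A by rewrite mulr_ge0 ?exprn_ge0.
have P0 j j' : 0 <= A * (kap ^+ j * 2 ^+ j').
  by apply: mulr_ge0 => //; rewrite mulr_ge0 ?exprn_ge0.
have /andP[_ /ltW k1] : 2^-1 <= kap < 1 := cesaro_ratio_itv a0.
have B0 : 0 <= 1 + a by rewrite addr_ge0// ltW.
have [[k' k'p xk']|no] := pselect (exists2 j, (j < p)%N & x j); last first.
  exists 0%N, p; split; first exact: pN.
    move=> j /andP[_ jN]; have [jp|jp|->] := ltngtP j p.
    - by apply/negbTE/negP => xj; apply: no; exists j.
    - by rewrite px// jp.
    - by rewrite xp.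
  apply: (le_trans (@dyadic_transform_cesaro_le1 _ a M a0 _ _ (N - 1 - p) _ _ _ mM _)).
  - exact: reversed_signs_norm.
  - lia.
  - exact: sg.
  rewrite -/kap -/A subn0.
  have h := pow2_le (N - 1 - p) p.+1.
  have E : (N - 1 - p + p.+1 = N)%N by lia.
  rewrite E in h.
  apply: (@le_trans _ _ (2 ^+ N * kap ^+ p.+1 * (1 * (1 + a) * (kap ^+ (M - N) * A)))).
    by rewrite mul1r ler_wpM2r// mulr_ge0.
  have -> : 2 ^+ N * kap ^+ p.+1 * (1 * (1 + a) * (kap ^+ (M - N) * A)) =
     kap * (1 * (1 + a) * A * (kap ^+ (M - N + p) * 2 ^+ N)).
    by rewrite exprD exprS; ring.
  apply: (@le_trans _ _ (1 * (1 * (1 + a) * A * (kap ^+ (M - N + p) * 2 ^+ N)))).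
    by rewrite ler_wpM2r// mul1r -mulrA mulr_ge0.
  rewrite mul1r -(mulrA (1 * _)) -(mulrA (3 * _)) ler_wpM2r// ler_wpM2r//.
  by rewrite -subr_ge0; lra.
have [p' /andP[_ p'p] [xp' p'x]] := last_true k'p xk'.
exists p'.+1, p; split; first by rewrite p'p.
  move=> j /andP[p'j jN]; have [jp|jp|->] := ltngtP j p.
  - by rewrite p'x// p'j.
  - by rewrite px// jp.
  - by rewrite xp.
apply: (le_trans (@dyadic_transform_cesaro_le2 _ a M a0 _ _ (N - 1 - p) (N - 1 - p')
   _ _ _ _ _ mM _ _)).
- exact: reversed_signs_norm.
- lia.
- lia.
- lia.
- exact: sg.
- by apply: sg => //; lia.
rewrite -/kap -/A.
have h := pow2_le (N - 1 - p) (p - p').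
have E : (N - 1 - p + (p - p') = N - p'.+1)%N by lia.
rewrite E in h.
apply: (@le_trans _ _ (2 ^+ (N - p'.+1) * kap ^+ (p - p') *
   (3 * (1 + a) * (kap ^+ (M - (N - 1 - p')) * A)))).
  by rewrite ler_wpM2r// mulr_ge0// mulr_ge0.
have -> : (M - (N - 1 - p') = M - N + p'.+1)%N by lia.
have -> : 2 ^+ (N - p'.+1) * kap ^+ (p - p') * (3 * (1 + a) * (kap ^+ (M - N + p'.+1) * A))
   = kap * (3 * (1 + a) * A * (kap ^+ (M - N + p) * 2 ^+ (N - p'.+1))).
  have -> : (M - N + p = M - N + p' + (p - p'))%N by lia.
  by rewrite addnS exprS [in RHS]exprD; ring.
by rewrite ler_piMl// -mulrA mulr_ge0// mulr_ge0.
Qed.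

End kaczmarz_kernel.

(** * The majorant of the one-dimensional kernel *)

Section kernel_bound.
Variable R : realType.
Implicit Types (x z : walsh_group) (N K M t p m : nat).

Definition box_weight (rho : R) (w : nat * nat * nat) : R := rho ^+ (w.1.1 + w.1.2 + w.2).

(** The majorant of the kernels of order at most [2 ^ M]: a superposition of
    normalized boxes in which both a loss of [m] levels and boxes that are free or
    shifted far from the origin have geometrically small weights. *)
Definition box_majorant (rho : R) (Lam M : nat) z : R :=
  \sum_(w : 'I_Lam * 'I_Lam * 'I_Lam)
    box_weight rho (w.1.1 : nat, w.1.2 : nat, w.2 : nat) ^+ 2 *
    box_kernel R (M - w.1.1) w.1.2 w.2 z.

Lemma box_majorantE rho Lam M z : box_majorant rho Lam M z =
  \sum_(m < Lam) \sum_(t < Lam) \sum_(p < Lam)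
    box_weight rho (m : nat, t : nat, p : nat) ^+ 2 * box_kernel R (M - m) t p z.
Proof. by rewrite /box_majorant pair_bigA pair_bigA. Qed.

Lemma cesaro_kernel_sum_ext a n M x : (n <= 2 ^ M)%N ->
  \sum_(i < n) cesaro_number a (n - 1 - i) * kaczmarz R i x =
  \sum_(i < 2 ^ M) cesaro_ext a (n%:Z - 1 - i%:Z) * kaczmarz R i x.
Proof.
move=> nM; rewrite (big_ord_widen _ (fun i => cesaro_number a (n - 1 - i) * kaczmarz R i x) nM).
rewrite big_mkcond; apply: eq_bigr => i _; case: ltnP => ni.
  by congr (_ * _); have -> : n%:Z - 1 - i%:Z = (n - 1 - i)%N%:Z by lia.
by rewrite cesaro_ext_lt0 ?mul0r//; lia.
Qed.

Variable a : R.
Hypothesis a0 : 0 < a.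
Let kap := cesaro_ratio a.
Let rho := Num.sqrt (Num.sqrt kap).

Let rho4 : rho ^+ 4 = kap.
Proof.
have k0 := cesaro_ratio_gt0 a0.
by rewrite (exprM rho 2 2) /rho !sqr_sqrtr ?sqrtr_ge0// ltW.
Qed.

Let rho0 : 0 < rho.
Proof. by rewrite !sqrtr_gt0 cesaro_ratio_gt0. Qed.

Let rho1 : rho < 1.
Proof.
have /andP[_ k1] := cesaro_ratio_itv a0.
by rewrite -(@ltr_pXn2r _ 4)// ?nnegrE ?(ltW rho0)// rho4 expr1n.
Qed.

Let rho2 : 1 <= 2 * rho ^+ 2.
Proof.
have /andP[k2 _] := cesaro_ratio_itv a0.
rewrite -ler_pdivrMl// mulr1; apply: (le_trans k2).
by rewrite -/kap -rho4 ler_wiXn2l// ltW.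
Qed.

Let term_le Lam M z (m t p : nat) : (m < Lam)%N -> (t < Lam)%N -> (p < Lam)%N ->
  box_weight rho (m, t, p) ^+ 2 * box_kernel R (M - m) t p z <=
  \sum_(t < Lam) \sum_(p < Lam)
    box_weight rho (m : nat, t : nat, p : nat) ^+ 2 * box_kernel R (M - m) t p z.
Proof.
move=> mL tL pL.
have T0 u v : 0 <= box_weight rho (m, u, v) ^+ 2 * box_kernel R (M - m) u v z.
  by rewrite mulr_ge0 ?box_kernel_ge0// sqr_ge0.
rewrite (bigD1 (Ordinal tL))//= (bigD1 (Ordinal pL))//= -addrA lerDl.
by apply: addr_ge0; apply: sumr_ge0 => *//; apply: sumr_ge0.
Qed.

(** Let [K] be the first nonzero coordinate of [x]. The functions of index less than
    [2 ^ K] are 1 at [x] and those of the next block are -1, so together they give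
    differences with step [2 ^ K]. Each later block is dominated by one box. *)
Lemma cesaro_kernel_bound : exists C : R, exists rho : R,
  [/\ 0 <= C, 0 < rho < 1 & forall n M Lam x, (n <= 2 ^ M)%N -> (M.+1 < Lam)%N ->
    `|\sum_(i < n) cesaro_number a (n - 1 - i) * kaczmarz R i x| <=
    C * cesaro_number a (2 ^ M) * box_majorant rho Lam M x].
Proof.
exists (12 * (1 + a)), rho; split.
- by rewrite mulr_ge0// addr_ge0// ltW.
- by rewrite rho0.
move=> n M Lam x nM ML; rewrite (cesaro_kernel_sum_ext a x nM) box_majorantE.
set A := cesaro_number a (2 ^ M).
have a1 : -1 < a by rewrite (lt_trans (ltrN10 _)).
have A0 : 0 < A by exact: cesaro_number_gt0.
set D := 12 * (1 + a); have D0 : 0 < D by rewrite mulr_gt0// addr_gt0.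
pose G (m : nat) := \sum_(t < Lam) \sum_(p < Lam)
    box_weight rho (m : nat, t : nat, p : nat) ^+ 2 * box_kernel R (M - m) t p x.
have G0 m : 0 <= G m.
  apply: sumr_ge0 => t _; apply: sumr_ge0 => p _.
  by rewrite mulr_ge0 ?box_kernel_ge0// sqr_ge0.
have mM : n%:Z - 1 <= (2 ^ M)%N%:Z by lia.
(* a dyadic interval around the origin is covered by the box (1, 0), so that a single
   family of boxes suffices *)
have origin N : (N <= M)%N -> (forall k, (k < N)%N -> x k = false) ->
    rho ^+ (4 * (M - N)) * 2 ^+ N <= 4 * G (M - N)%N.
  move=> NM x0.
  have xb : dyadic_box N 1 0 x.
    by move=> k /andP[k1 kN]; rewrite x0//; case: k k1 {kN}.
  have mL : (M - N < Lam)%N by lia.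
  have tL : (1 < Lam)%N by lia.
  have pL : (0 < Lam)%N by lia.
  have := term_le M x mL tL pL.
  rewrite -/(G _) subKn// box_kernelE// => /(ler_wpM2l (ler0n R 4)); apply: le_trans.
  rewrite /box_weight /= addn0 addn1.
  have -> : (2 ^+ N : R) = 2 ^+ (N - (N == 0%N == false)) * (1 + (N != 0%N)%:R).
    by case: N {NM x0 xb mL} => [|N]; rewrite ?subn0 ?expr0 ?subn1 ?exprSr ?addr0 ?mul1r//=.
  have -> : (N - (N == 0%N == false) = N - 1)%N by case: N {NM x0 xb mL}.
  rewrite -exprM.
  have -> : ((M - N).+1 * 2 = 2 + (M - N) * 2)%N by lia.
  have -> : (4 * (M - N) = (M - N) * 2 + (M - N) * 2)%N by lia.
  rewrite !exprD.
  set u := rho ^+ ((M - N) * 2); have u0 : 0 <= u by rewrite exprn_ge0// ltW.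
  have u1 : u <= 1 by rewrite exprn_ile1// ltW.
  set v := 2 ^+ (N - 1); have v0 : 0 <= v by rewrite exprn_ge0.
  apply: (@le_trans _ _ (u * v * 2)).
    have uv : 0 <= u * v by rewrite mulr_ge0.
    rewrite -(mulrA u) -(mulrA u v 2); apply: ler_wpM2l => //.
    rewrite mulrA; apply: ler_pM => //.
    - by rewrite ler_piMl.
    - by case: (N != 0%N) => /=; lra.
  have -> : 4 * (rho ^+ 2 * u * v) = u * v * 2 * (2 * rho ^+ 2) by ring.
  by rewrite ler_peMr ?rho2// !mulr_ge0.
have A2 (p : int) : p <= (2 ^ M)%N%:Z -> 0 <= cesaro_ext a p <= A.
  move=> pM; rewrite cesaro_ext_ge0//=; have -> : A = cesaro_ext a (2 ^ M)%N%:Z by [].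
  by rewrite cesaro_ext_ndecr// ltW.
have [zero|nz] := pselect (forall k, (k < M)%N -> x k = false).
  rewrite kaczmarz_sum_zero//.
  apply: (@le_trans _ _ (2 ^+ M * A)).
    apply: le_trans (ler_norm_sum _ _ _) _.
    rewrite -natrX mulr_natl -[X in _ *+ X]card_ord -sumr_const; apply: ler_sum => j _.
    have jM : n%:Z - 1 - j%:Z <= (2 ^ M)%N%:Z by lia.
    by have /andP[? ?] := A2 _ jM; rewrite ger0_norm.
  have := origin M (leqnn _) zero; rewrite subnn expr0 mul1r => o.
  have L0 : (0 < Lam)%N by lia.
  apply: (@le_trans _ _ (D * A * G 0%N)); last first.
    rewrite ler_pM2l ?(mulr_gt0 D0 A0)// (bigD1 (Ordinal L0))//= lerDl.
    by apply: sumr_ge0 => i _; exact: G0.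
  rewrite [leRHS]mulrAC ler_pM2r//; apply: (le_trans o).
  rewrite ler_wpM2r// /D. have := a0; lra.
have [K [KM xK x0]] : exists K, [/\ (K < M)%N, x K & forall k, (k < K)%N -> x k = false].
  have ex : exists k, (k < M)%N && x k.
    apply: contrapT => no; apply: nz => k kM; apply/negbTE/negP => xk.
    by apply: no; exists k; rewrite kM.
  case: (ex_minnP ex) => K /andP[KM xK] min; exists K; split => // k kK.
  apply/negbTE/negP => xk; have := min k; rewrite xk (ltn_trans kK KM) => /(_ isT).
  by rewrite leqNgt kK.
rewrite (kaczmarz_sum_blocks _ _ _ (ltnW KM)) big_ltn// addrA.
have step : `|\sum_(i < 2 ^ K) cesaro_ext a (n%:Z - 1 - i%:Z) * kaczmarz R i x +
    rademacher R K x * dyadic_transform (reversed_signs R x K) K (cesaro_ext a)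
      (n%:Z - 1 - (2 ^ K)%N%:Z)| <= D * A * G (M - K)%N.
  rewrite kaczmarz_sum_zero// (@eq_dyadic_transform _ _ (fun=> 1)) => [|k kK]; last first.
    exact: (reversed_signs1 R x0).
  rewrite dyadic_transform1 /rademacher xK expr1 mulN1r -sumrB.
  apply: (@le_trans _ _ (2 ^+ K * ((1 + a) * (kap ^+ (M - K) * A)))).
    apply: le_trans (ler_norm_sum _ _ _) _.
    rewrite -natrX mulr_natl -[X in _ *+ X]card_ord -sumr_const; apply: ler_sum => j _.
    rewrite [n%:Z - 1 - _ - _]addrAC ger0_norm; last first.
      by rewrite subr_ge0 cesaro_ext_ndecr//; [exact: ltW|lia].
    by apply: window_cesaro_le => //; [exact: ltnW|lia].
  have := origin K (ltnW KM) x0; rewrite exprM rho4 => o.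
  have -> : 2 ^+ K * ((1 + a) * (kap ^+ (M - K) * A)) =
     (1 + a) * A * (kap ^+ (M - K) * 2 ^+ K) by ring.
  have C0 : 0 <= (1 + a) * A by rewrite mulr_ge0 ?(ltW A0)// addr_ge0// ltW.
  apply: le_trans (ler_wpM2l C0 o) _.
  have -> : D * A * G (M - K)%N = (1 + a) * A * (12 * G (M - K)%N) by rewrite /D; ring.
  by rewrite ler_wpM2l// ler_wpM2r//; lra.
have tail N : (K < N < M)%N ->
   `|rademacher R N x * dyadic_transform (reversed_signs R x N) N (cesaro_ext a)
      (n%:Z - 1 - (2 ^ N)%N%:Z)| <= D * A * G (M - N)%N.
  move=> /andP[KN NM]; rewrite normrM.
  have -> : `|rademacher R N x| = 1 by rewrite /rademacher normrX normrN1 expr1n.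
  rewrite mul1r.
  have KNM : (K < N <= M)%N by rewrite KN ltnW.
  have m2 : n%:Z - 1 - (2 ^ N)%N%:Z <= (2 ^ M)%N%:Z by lia.
  have [t [p [/andP[tp pN] xb]]] := kaczmarz_block_le a0 KNM xK m2.
  move=> /le_trans; apply.
  have mL : (M - N < Lam)%N by lia.
  have tL : (t < Lam)%N by lia.
  have pL : (p < Lam)%N by lia.
  have := term_le M x mL tL pL; rewrite -/(G _) subKn ?(ltnW NM)// box_kernelE// => g.
  apply: (@le_trans _ _ (D * A * (box_weight rho ((M - N)%N, t, p) ^+ 2 * 2 ^+ (N - t)))); last first.
    by rewrite ler_pM2l ?(mulr_gt0 D0 A0).
  apply: ler_pM.
  - by rewrite mulr_ge0 ?(ltW A0)// mulr_ge0// addr_ge0// ltW.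
  - by rewrite mulr_ge0 ?exprn_ge0// ltW// cesaro_ratio_gt0.
  - by rewrite ler_wpM2r ?(ltW A0)// ler_wpM2r ?ler_nat// addr_ge0// ltW.
  rewrite ler_wpM2r ?exprn_ge0// -/kap -rho4 /box_weight /= -!exprM.
  by apply: ler_wiXn2l; rewrite ?(ltW rho0) ?(ltW rho1)//; lia.
apply: (@le_trans _ _ (\sum_(K <= N < M) D * A * G (M - N)%N)).
  rewrite [leRHS]big_ltn//; apply: le_trans (ler_normD _ _) _; apply: lerD => //.
  apply: le_trans (ler_norm_sum _ _ _) _.
  by rewrite !big_nat; apply: ler_sum => N /tail.
rewrite -mulr_sumr ler_pM2l ?(mulr_gt0 D0 A0)//.
apply: (@le_trans _ _ (\sum_(0 <= N < M) G (M - N)%N)).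
  rewrite [leRHS](big_cat_nat (leq0n K) (ltnW KM))/= lerDr.
  by apply: sumr_ge0 => i _; exact: G0.
rewrite big_nat_rev/= add0n (eq_big_nat _ _ (F2 := fun i => G i.+1)) => [|i /andP[_ iM]]; last first.
  by congr G; lia.
rewrite -(big_mkord xpredT G) (big_cat_nat (leq0n M.+1) (ltnW ML))/=.
rewrite big_nat_recl//= -addrA [leRHS]addrCA lerDl.
by apply: addr_ge0 => //; apply: sumr_ge0 => i _; exact: G0.
Qed.

End kernel_bound.

(** * Product sums and measurability *)

Section dependent_sums.
Variable R : comPzRingType.

(** Distributivity when the range of summation depends on the factor. *)
Lemma prod_sum_dffun (I : finType) (T_ : I -> finType) (F : forall i, T_ i -> R) :
  \prod_i \sum_(j : T_ i) F i j = \sum_(t : {dffun forall i, T_ i}) \prod_i F i (t i).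
Proof.
pose P_ i : {ffun T_ i -> R} := [ffun j => F i j].
have -> : \prod_i \sum_(j : T_ i) F i j = \prod_i \sum_(j : T_ i) P_ i j.
  by apply: eq_bigr => i _; apply: eq_bigr => j _; rewrite ffunE.
under eq_bigr do rewrite (big_tag P_).
rewrite bigA_distr_big_dep/= -(big_fprod _ _ P_).
rewrite (reindex (@fprod_of_dffun _ T_)); last exact/onW_bij/fprod_of_dffun_bij.
by apply: eq_bigr => t _; apply: eq_bigr => i _; rewrite ffunE fprodE.
Qed.

End dependent_sums.

Section cesaro_sum.
Variable R : realType.

Lemma cesaro_number_sum (a : R) n :
  \sum_(l < n.+1) cesaro_number (a - 1) l = cesaro_number a n.
Proof.
elim: n => [|n IH]; first by rewrite big_ord1 !cesaro_number0.
by rewrite big_ord_recr/= IH -cesaro_number_pascal.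
Qed.

Lemma cesaro_sum_partial_sums (a : R) n (g : nat -> R) :
  \sum_(k < n.+1) cesaro_number (a - 1) (n - k) * \sum_(i < k) g i =
  \sum_(i < n) cesaro_number a (n - 1 - i) * g i.
Proof.
transitivity (\sum_(k < n.+1) \sum_(i < n | (i < k)%N) cesaro_number (a - 1) (n - k) * g i).
  apply: eq_bigr => k _; rewrite mulr_sumr.
  by rewrite (big_ord_widen _ (fun i => cesaro_number (a - 1) (n - k) * g i) (leq_ord k)).
rewrite (exchange_big_dep xpredT)//=; apply: eq_bigr => i _.
rewrite -mulr_suml; congr (_ * _).
rewrite (reindex_inj rev_ord_inj)/= -cesaro_number_sum.
rewrite (big_ord_widen n.+1 (cesaro_number (a - 1))); last by have := ltn_ord i; lia.
apply: eq_big => k /=; last by move=> _; congr cesaro_number; have := ltn_ord k; lia.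
by apply/idP/idP; have := ltn_ord k; have := ltn_ord i; lia.
Qed.

End cesaro_sum.

Section walsh_measurability.
Variable R : realType.

Lemma measurable_coord k :
  measurable_fun [set: walsh_group] (fun x : walsh_group => (x : cantor_space) k).
Proof.
have mt : measurable [set x : walsh_group | (x : cantor_space) k = true].
  apply: sub_sigma_algebra.
  suff : @open cantor_space ((@proj nat (fun=> bool) k) @^-1` [set true]) by [].
  apply: open_comp => [x _|]; first exact: proj_continuous.
  exact: discrete_open.
move=> _ Y mY; rewrite setTI.
have [Yt|Yt] := pselect (Y true); have [Yf|Yf] := pselect (Y false).
- by rewrite (_ : _ @^-1` _ = setT)//; apply/seteqP; split=> // x _ /=; case: (_ k).
- rewrite (_ : _ @^-1` _ = [set x : walsh_group | (x : cantor_space) k = true])//.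
  by apply/seteqP; split=> x /=; case: (_ k).
- rewrite (_ : _ @^-1` _ = ~` [set x : walsh_group | (x : cantor_space) k = true]).
    exact: measurableC.
  by apply/seteqP; split=> x /=; case: (_ k).
- by rewrite (_ : _ @^-1` _ = set0)//; apply/seteqP; split=> // x /=; case: (_ k).
Qed.

Lemma measurable_rademacher k : measurable_fun [set: walsh_group] (rademacher R k).
Proof.
move=> _ Y mY; pose Z := [set b : bool | Y ((-1) ^+ b)].
have mZ : measurable Z by [].
exact: (@measurable_coord k measurableT Z mZ).
Qed.

Lemma measurable_kaczmarz n : measurable_fun [set: walsh_group] (kaczmarz R n).
Proof.
rewrite /kaczmarz; case: eqP => _; first exact: measurable_cst.
apply: measurable_funM; first exact: measurable_rademacher.
apply: measurable_prod => k _; apply: measurable_funX; exact: measurable_rademacher.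
Qed.

Lemma kaczmarz_norm n x : `|kaczmarz R n x| = 1.
Proof.
have r1 k : `|rademacher R k x| = 1 by rewrite /rademacher normrX normrN1 expr1n.
rewrite /kaczmarz; case: eqP => _; first by rewrite normr1.
by rewrite normrM r1 mul1r normr_prod big1// => k _; rewrite normrX r1 expr1n.
Qed.

Lemma kaczmarz_translate n x y :
  kaczmarz R n (walsh_translate x y) = kaczmarz R n y * kaczmarz R n x.
Proof.
have rT k : rademacher R k (walsh_translate x y) = rademacher R k y * rademacher R k x.
  by rewrite /rademacher /walsh_translate signr_addb.
rewrite /kaczmarz; case: eqP => _; first by rewrite mulr1.
rewrite rT mulrACA -big_split/=; congr (_ * _).
by apply: eq_bigr => k _; rewrite rT exprMn.
Qed.

Lemma measurable_dyadic_box N t p : measurable (dyadic_box N t p).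
Proof.
rewrite (_ : dyadic_box N t p = \bigcap_(k in [set k | (t <= k < N)%N])
    ((fun x : walsh_group => (x : cantor_space) k) @^-1` [set (k == p)])); last first.
  by apply/seteqP; split => x xb k kN; exact: xb.
apply: bigcap_measurableType => k _.
by rewrite -[X in measurable X]setTI; exact: measurable_coord.
Qed.

Lemma measurable_box_kernel N t p : measurable_fun [set: walsh_group] (box_kernel R N t p).
Proof.
by apply: measurable_funM => //; apply: measurable_indic; exact: measurable_dyadic_box.
Qed.

Lemma measurable_fun_walsh_translate2 :
  measurable_fun [set: walsh_group * walsh_group] (fun xy => walsh_translate xy.1 xy.2).
Proof.
have := @measurability _ _ _ _ setT
  (fun xy : walsh_group * walsh_group => walsh_translate xy.1 xy.2) _ walsh_group_measurableE.
apply=> _ [_ [[n a] _ <-] <-]; rewrite setTI.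
rewrite (_ : _ @^-1` _ = \bigcap_(k in [set k | (k < n)%N])
    ((fun xy : walsh_group * walsh_group => xy.2 k (+) xy.1 k) @^-1` [set a k])).
  apply: bigcap_measurableType => k _; rewrite -[X in measurable X]setTI.
  have m1 : measurable_fun [set: walsh_group * walsh_group]
      (fun xy : walsh_group * walsh_group => (xy.1 : cantor_space) k).
    exact: (measurableT_comp (measurable_coord k) measurable_fst).
  have m2 : measurable_fun [set: walsh_group * walsh_group]
      (fun xy : walsh_group * walsh_group => (xy.2 : cantor_space) k).
    exact: (measurableT_comp (measurable_coord k) measurable_snd).
  suff m : measurable_fun [set: walsh_group * walsh_group]
     (fun xy : walsh_group * walsh_group => xy.2 k (+) xy.1 k) by exact: m.
  rewrite (_ : (fun _ => _) = fun xy : walsh_group * walsh_group =>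
     (xy.2 k && ~~ xy.1 k) || (~~ xy.2 k && xy.1 k)); last first.
    by apply/funext => xy; case: (xy.1 k); case: (xy.2 k).
  by apply: measurable_or; apply: measurable_and => //; exact: measurable_neg.
by apply/seteqP; split => xy xyb k kn; exact: xyb.
Qed.

End walsh_measurability.

(** * Cesaro means as integrals *)

Section finite_sums.
Context d (T : measurableType d) (R : realType) (mu : {measure set T -> \bar R}).

Lemma integrable_Rsum I (s : seq I) (F : I -> T -> R) :
  (forall i, mu.-integrable setT (EFin \o F i)) ->
  mu.-integrable setT (EFin \o (fun x => \sum_(i <- s) F i x)).
Proof.
move=> iF; rewrite (_ : EFin \o _ = (fun x => \sum_(i <- s) (F i x)%:E)%E).
  exact: (@integrable_sum _ _ _ _ setT measurableT I s xpredT (fun i => EFin \o F i)).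
by apply/funext => x /=; rewrite sumEFin.
Qed.

Lemma Rintegral_sum I (s : seq I) (F : I -> T -> R) :
  (forall i, mu.-integrable setT (EFin \o F i)) ->
  \int[mu]_x (\sum_(i <- s) F i x) = \sum_(i <- s) \int[mu]_x F i x.
Proof.
move=> iF; elim: s => [|i s IH].
  under eq_Rintegral do rewrite big_nil.
  by rewrite /Rintegral integral0 big_nil.
rewrite big_cons -IH -RintegralD//; last exact: integrable_Rsum.
by apply: eq_Rintegral => x _; rewrite big_cons.
Qed.

End finite_sums.

Section product_kernels.
Variables (R : realType) (D : nat).
Local Notation T := (D.-tuple walsh_group).
Implicit Types (x y : T) (F : 'I_D -> walsh_group -> R).

(** The tensor product of the functions [F j], as a convolution kernel. *)
Definition product_kernel F x y : R :=
  \prod_(j < D) F j (walsh_translate (tnth x j) (tnth y j)).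

Lemma walsh_translateC (u v : walsh_group) : walsh_translate u v = walsh_translate v u.
Proof. by apply/funext => k; rewrite /walsh_translate addbC. Qed.

Lemma product_kernelC F x y : product_kernel F x y = product_kernel F y x.
Proof. by apply: eq_bigr => j _; rewrite walsh_translateC. Qed.

Lemma product_kernel_ge0 F x y : (forall j z, 0 <= F j z) -> 0 <= product_kernel F x y.
Proof. by move=> F0; apply: prodr_ge0. Qed.

Lemma measurable_product_kernel F : (forall j, measurable_fun setT (F j)) ->
  measurable_fun [set: T * T] (fun xy => product_kernel F xy.1 xy.2).
Proof.
move=> mF; apply: measurable_prod => j _; apply: measurableT_comp => //.
have mj : measurable_fun [set: T * T]
    (fun xy : T * T => (tnth xy.1 j, tnth xy.2 j)).
  apply/measurable_fun_pair => /=.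
    exact: (measurableT_comp (measurable_tnth j) measurable_fst).
  exact: (measurableT_comp (measurable_tnth j) measurable_snd).
exact: (measurableT_comp measurable_fun_walsh_translate2 mj).
Qed.

Lemma measurable_product_kernel1 F x : (forall j, measurable_fun setT (F j)) ->
  measurable_fun [set: T] (product_kernel F x).
Proof.
move=> mF.
exact: (measurableT_comp (measurable_product_kernel mF) (pair1_measurable x)).
Qed.

Definition cesaro_kernel (a : R) n (z : walsh_group) : R :=
  \sum_(i < n) cesaro_number a (n - 1 - i) * kaczmarz R i z.

Lemma measurable_cesaro_kernel a n : measurable_fun setT (cesaro_kernel a n).
Proof.
apply: measurable_sum => i; apply: measurable_funM => //.
exact: measurable_kaczmarz.
Qed.

Lemma measurable_kaczmarz_prod k : measurable_fun [set: T] (kaczmarz_prod R k).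
Proof.
apply: measurable_prod => j _.
exact: (measurableT_comp (@measurable_kaczmarz _ _) (measurable_tnth j)).
Qed.

Lemma kaczmarz_prod_norm k x : `|kaczmarz_prod R k x| = 1.
Proof. by rewrite normr_prod big1// => j _; exact: kaczmarz_norm. Qed.

Let mu := haar_prod R D.

Lemma integrable_kaczmarz f k : mu.-integrable setT (EFin \o f) ->
  mu.-integrable setT (EFin \o (fun y => f y * kaczmarz_prod R k y)).
Proof.
move=> intf; apply: (le_integrable _ _ _ intf) => //.
  have mf := measurable_int _ intf.
  apply/measurable_EFinP/measurable_funM; first exact/measurable_EFinP.
  exact: measurable_kaczmarz_prod.
by move=> y _; rewrite /= normrM kaczmarz_prod_norm mulr1.
Qed.

Lemma product_cesaro_kernel (alpha : 'I_D -> R) n x y :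
  product_kernel (fun j => cesaro_kernel (alpha j) (n j)) x y =
  \sum_(k : {dffun forall i : 'I_D, 'I_(n i).+1})
    (\prod_(i < D) cesaro_number (alpha i - 1) (n i - k i)) *
    \sum_(i : {dffun forall j : 'I_D, 'I_(k j)})
      kaczmarz_prod R (fun j => i j) y * kaczmarz_prod R (fun j => i j) x.
Proof.
rewrite /product_kernel /cesaro_kernel.
under eq_bigr => j _ do rewrite -(cesaro_sum_partial_sums _ _ (fun i => kaczmarz R i _)).
rewrite (prod_sum_dffun (T_ := fun j => 'I_(n j).+1) (fun j k =>
  cesaro_number (alpha j - 1) (n j - k) *
  \sum_(i < k) kaczmarz R i (walsh_translate (tnth x j) (tnth y j)))).
apply: eq_bigr => k _; rewrite big_split/=; congr (_ * _).
rewrite (prod_sum_dffun (T_ := fun j => 'I_(k j)) (fun j i =>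
  kaczmarz R i (walsh_translate (tnth x j) (tnth y j)))).
apply: eq_bigr => i _; rewrite -big_split/=.
by apply: eq_bigr => j _; rewrite kaczmarz_translate.
Qed.

Lemma cesaro_meanE (alpha : 'I_D -> R) n f x : mu.-integrable setT (EFin \o f) ->
  cesaro_mean alpha n f x = (\prod_(i < D) cesaro_number (alpha i) (n i))^-1 *
    \int[mu]_y (f y * product_kernel (fun j => cesaro_kernel (alpha j) (n j)) x y).
Proof.
move=> intf; rewrite /cesaro_mean; congr (_ * _).
under eq_Rintegral do rewrite product_cesaro_kernel mulr_sumr.
have intk (k : {dffun forall i : 'I_D, 'I_(n i).+1}) : mu.-integrable setT (EFin \o (fun y =>
    f y * ((\prod_(i < D) cesaro_number (alpha i - 1) (n i - k i)) *
    \sum_(i : {dffun forall j : 'I_D, 'I_(k j)})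
      kaczmarz_prod R (fun j => i j) y * kaczmarz_prod R (fun j => i j) x))) /\
   \int[mu]_y (f y * ((\prod_(i < D) cesaro_number (alpha i - 1) (n i - k i)) *
    \sum_(i : {dffun forall j : 'I_D, 'I_(k j)})
      kaczmarz_prod R (fun j => i j) y * kaczmarz_prod R (fun j => i j) x)) =
   (\prod_(i < D) cesaro_number (alpha i - 1) (n i - k i)) *
    kaczmarz_partial_sum (fun i => k i) f x.
  set c := \prod_(i < D) _.
  pose G (i : {dffun forall j : 'I_D, 'I_(k j)}) y :=
    (c * kaczmarz_prod R (fun j => i j) x) * (f y * kaczmarz_prod R (fun j => i j) y).
  have iG i : mu.-integrable setT (EFin \o G i).
    apply: (@eq_integrable _ _ _ mu setT measurableT (fun y =>
     ((c * kaczmarz_prod R (fun j => i j) x)%:E * (f y * kaczmarz_prod R (fun j => i j) y)%:E)%E)).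
      by move=> y _.
    by apply: integrableZl => //; exact: integrable_kaczmarz.
  have -> : (fun y => f y * (c * \sum_(i : {dffun forall j : 'I_D, 'I_(k j)})
      kaczmarz_prod R (fun j => i j) y * kaczmarz_prod R (fun j => i j) x)) =
      (fun y => \sum_i G i y).
    apply/funext => y; rewrite mulrA mulr_sumr; apply: eq_bigr => i _.
    by rewrite /G; ring.
  split; first exact: integrable_Rsum.
  rewrite Rintegral_sum// /kaczmarz_partial_sum mulr_sumr; apply: eq_bigr => i _.
  rewrite RintegralZl//; last exact: integrable_kaczmarz.
  by rewrite /kaczmarz_coef -/mu; ring.
rewrite Rintegral_sum; last by move=> k; have [] := intk k.
by apply: eq_bigr => k _; have [_ ->] := intk k.
Qed.

Lemma measurable_cesaro_mean (alpha : 'I_D -> R) n f :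
  measurable_fun setT (cesaro_mean alpha n f).
Proof.
apply: measurable_funM => //; apply: measurable_sum => k.
apply: measurable_funM => //; apply: measurable_sum => i.
apply: measurable_funM => //; exact: measurable_kaczmarz_prod.
Qed.

(** Any pointwise majorants [F j] of the normalized one-dimensional kernels give a
    positive integral operator that dominates the Cesaro mean. *)
Lemma cesaro_mean_le (alpha : 'I_D -> R) n f x (C : 'I_D -> R) F :
  mu.-integrable setT (EFin \o f) ->
  (forall j, 0 < cesaro_number (alpha j) (n j)) -> (forall j, 0 <= C j) ->
  (forall j z, 0 <= F j z) -> (forall j, measurable_fun setT (F j)) ->
  (forall j z, `|cesaro_kernel (alpha j) (n j) z| <=
     C j * cesaro_number (alpha j) (n j) * F j z) ->
  (`|cesaro_mean alpha n f x|%:E <=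
   (\prod_j C j)%:E * \int[mu]_y (`|f y| * product_kernel F x y)%:E)%E.
Proof.
move=> intf A0 C0 F0 mF CF; rewrite cesaro_meanE//.
set A := \prod_(i < D) _; have AA : 0 < A by apply: prodr_gt0.
set k := product_kernel (fun j => cesaro_kernel (alpha j) (n j)) x.
have mk : measurable_fun setT k.
  by apply: measurable_product_kernel1 => j; exact: measurable_cesaro_kernel.
have mf : measurable_fun setT f by apply/measurable_EFinP; exact: measurable_int intf.
have kF y : `|k y| <= (\prod_j C j) * A * product_kernel F x y.
  rewrite /k /product_kernel normr_prod -!big_split/=.
  by apply: ler_prod => j _; rewrite normr_ge0 CF.
have PC : 0 <= \prod_j C j by apply: prodr_ge0.
apply: (@le_trans _ _ ((A^-1)%:E * \int[mu]_y (`|f y * k y|)%:E)%E).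
  rewrite normrM gtr0_norm ?invr_gt0// EFinM; apply: lee_wpmul2l.
    by rewrite lee_fin invr_ge0 ltW.
  rewrite /Rintegral.
  have [fin|] := boolP (\int[mu]_y (f y * k y)%:E \is a fin_num)%E; last first.
    case: (\int[mu]_y (f y * k y)%:E)%E => //= _; rewrite normr0;
    by apply: integral_ge0 => y _; rewrite lee_fin.
  rewrite -[leLHS]/(`|(fine (\int[mu]_y (f y * k y)%:E))%:E|)%E fineK//.
  apply: (le_trans (le_abse_integral _ _ _)) => //.
  exact/measurable_EFinP/measurable_funM.
rewrite -!ge0_integralZl//.
- apply: ge0_le_integral => //.
  + by move=> y _; rewrite -EFinM lee_fin mulr_ge0// invr_ge0 ltW.
  + apply: measurable_funeM; apply/measurable_EFinP.
    by apply: measurableT_comp => //; exact: measurable_funM.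
  + apply: measurable_funeM; apply/measurable_EFinP; apply: measurable_funM.
      exact: measurableT_comp.
    exact: measurable_product_kernel1.
  + move=> y _; rewrite -!EFinM lee_fin ler_pdivrMl// normrM.
    rewrite [leRHS](_ : _ = `|f y| * ((\prod_j C j) * A * product_kernel F x y)); last by ring.
    by apply: ler_wpM2l.
- apply/measurable_EFinP; apply: measurable_funM; first exact: measurableT_comp.
  exact: measurable_product_kernel1.
- by move=> y _; rewrite lee_fin mulr_ge0// product_kernel_ge0.
- by apply/measurable_EFinP; apply: measurableT_comp => //; exact: measurable_funM.
- by rewrite lee_fin invr_ge0 ltW.
Qed.

End product_kernels.

(** * Maximal functions of nested kernels *)

Section nested_kernels.
Context d (T : measurableType d) (R : realType) (mu : probability T R).
Variable K : nat -> T -> T -> R.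
Hypothesis K_ge0 : forall a x y, 0 <= K a x y.
Hypothesis mK : forall a, measurable_fun [set: T * T] (fun xy => K a xy.1 xy.2).
Hypothesis K_le1 : forall a y, (\int[mu]_x (K a x y)%:E <= 1)%E.
Hypothesis K_nested : forall a a' x x' y, (a' <= a)%N ->
  K a x y != 0 -> K a' x' y != 0 -> forall z, K a' x z = K a' x' z.
Local Open Scope ereal_scope.

Lemma measurable_kernel_mean (k : T -> T -> R) (g : T -> R) :
  (forall x y, 0 <= k x y)%R -> measurable_fun [set: T * T] (fun xy => k xy.1 xy.2) ->
  (forall y, 0 <= g y)%R -> measurable_fun [set: T] g ->
  measurable_fun [set: T] (fun x => \int[mu]_y (g y * k x y)%:E).
Proof.
move=> k0 mk g0 mg.
have := @measurable_fun_fubini_tonelli_F _ _ _ _ _ mu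
  (fun xy : T * T => (g xy.2 * k xy.1 xy.2)%:E).
apply.
  apply/measurable_EFinP; apply: measurable_funM => //.
  exact: (measurableT_comp mg measurable_snd).
by move=> xy; rewrite lee_fin mulr_ge0.
Qed.

(** Stopping at the first [a] at which the mean exceeds [lambda] splits the set where
    the maximal function is large into disjoint pieces; since the kernels come from
    nested partitions, each [y] is seen by at most one of these pieces. *)
Lemma nested_kernel_weak_type (g : T -> R) (lambda : R) :
  (forall y, 0 <= g y)%R -> measurable_fun [set: T] g -> (0 < lambda)%R ->
  lambda%:E * mu [set x | exists a, lambda%:E < \int[mu]_y (g y * K a x y)%:E]
    <= \int[mu]_y (g y)%:E.
Proof.
move=> g0 mg l0.
pose B a x := \int[mu]_y (g y * K a x y)%:E.
have mB a : measurable_fun setT (B a) by exact: measurable_kernel_mean.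
pose E a := [set x | lambda%:E < B a x] `&`
  \bigcap_(a' in [set a' | (a' < a)%N]) [set x | B a' x <= lambda%:E].
have mE a : measurable (E a).
  apply: measurableI.
    by rewrite -[X in measurable X]setTI; exact: emeasurable_fun_o_infty.
  apply: bigcap_measurableType => a' _.
  by rewrite -[X in measurable X]setTI; exact: emeasurable_fun_infty_c.
have -> : [set x | exists a, lambda%:E < \int[mu]_y (g y * K a x y)%:E] = \bigcup_a E a.
  apply/seteqP; split => [x [a xa]|x [a _ [xa _]]]; last by exists a.
  have ex : exists a, `[< lambda%:E < B a x >] by exists a; exact/asboolP.
  case: (ex_minnP ex) => b /asboolP xb min; exists b => //; split=> // c /= cb.
  by rewrite leNgt; apply/negP => xc; have := min c (introT (asboolP _) xc); rewrite leqNgt cb.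
have tE : trivIset setT E.
  apply/trivIsetP => a b _ _; wlog ab : a b / (a < b)%N => [H|_].
    by rewrite neq_ltn => /orP[] ab; [|rewrite setIC]; apply: H => //; rewrite ltn_eqF.
  rewrite -subset0 => x [[xa _] [_ xb]].
  by have := xb _ ab; rewrite /= leNgt xa.
pose h a y := \int[mu]_x (\1_(E a) x * K a x y)%:E.
have mh' a : measurable_fun [set: T * T] (fun xy => \1_(E a) xy.1 * K a xy.1 xy.2)%R.
  apply: measurable_funM => //.
  have m1 : measurable_fun setT (\1_(E a) : T -> R) by exact: measurable_indic.
  exact: (measurableT_comp m1 measurable_fst).
have h'0 a x y : (0 <= \1_(E a) x * K a x y)%R by rewrite mulr_ge0.
have mh a : measurable_fun setT (h a).
  apply: (@measurable_fun_fubini_tonelli_G _ _ _ _ _ mu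
    (fun xy : T * T => (\1_(E a) xy.1 * K a xy.1 xy.2)%:E)).
    exact/measurable_EFinP.
  by move=> xy; rewrite lee_fin.
have h0 a y : 0 <= h a y by apply: integral_ge0 => x _; rewrite lee_fin.
have step1 a : lambda%:E * mu (E a) <= \int[mu]_y ((g y)%:E * h a y).
  apply: (@le_trans _ _ (\int[mu]_x ((\1_(E a) x)%:E * B a x))).
    rewrite -[E a in leLHS]setIT -integral_indic// -ge0_integralZl//; first last.
    - by rewrite lee_fin ltW.
    - exact/measurable_EFinP/measurable_indic.
    apply: ge0_le_integral => //.
    - by move=> x _; rewrite -EFinM lee_fin mulr_ge0// ltW.
    - apply: measurable_funeM; exact/measurable_EFinP/measurable_indic.
    - by apply: emeasurable_funM => //; exact/measurable_EFinP/measurable_indic.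
    move=> x _; rewrite indicE; case: (boolP (x \in E a)) => [|_].
      by rewrite inE => -[/ltW xa _]; rewrite mule1 mul1e.
    by rewrite mule0 mul0e.
  rewrite le_eqVlt; apply/orP; left; apply/eqP.
  transitivity (\int[mu]_x \int[mu]_y (g y * (\1_(E a) x * K a x y))%:E).
    apply: eq_integral => x _; rewrite -ge0_integralZl//.
    - by apply: eq_integral => y _; rewrite -EFinM mulrCA.
    - apply/measurable_EFinP/measurable_funM => //.
      exact: (measurableT_comp (mK a) (pair1_measurable x)).
    - by move=> y _; rewrite lee_fin mulr_ge0.
  pose F (xy : T * T) := (g xy.2 * (\1_(E a) xy.1 * K a xy.1 xy.2))%:E.
  have mF : measurable_fun setT F.
    apply/measurable_EFinP/measurable_funM => //.
    exact: (measurableT_comp mg measurable_snd).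
  have F0 xy : 0 <= F xy by rewrite lee_fin mulr_ge0.
  have := @fubini_tonelli _ _ _ _ _ mu mu F mF F0; rewrite /fubini_F /fubini_G /F /= => ->.
  apply: eq_integral => y _; rewrite /h -ge0_integralZl//.
  - apply/measurable_EFinP.
    exact: (measurableT_comp (mh' a) (pair2_measurable y)).
  - by move=> x _; rewrite lee_fin.
  - by rewrite lee_fin.
have hx a y : h a y != 0 -> exists2 x, E a x & K a x y != 0%R.
  move=> hn; apply: contrapT => no; move/eqP: hn; apply.
  apply: integral0_eq => x _; rewrite indicE; case: (boolP (x \in E a)) => [xE|_].
    have [->|Kn] := eqVneq (K a x y) 0%R; first by rewrite mulr0.
    by exfalso; apply: no; exists x => //; exact/set_mem.
  by rewrite mul0r.
have h1 a y : h a y <= 1.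
  apply: le_trans (K_le1 a y); apply: ge0_le_integral => //.
  - by move=> x _; rewrite lee_fin.
  - apply/measurable_EFinP; exact: (measurableT_comp (mh' a) (pair2_measurable y)).
  - apply/measurable_EFinP; exact: (measurableT_comp (mK a) (pair2_measurable y)).
  - move=> x _; rewrite lee_fin ler_piMl// indicE; by case: (_ \in _).
have hu a b y : (a < b)%N -> h a y != 0 -> h b y != 0 -> False.
  move=> ab /hx[x xE xK] /hx[x' x'E x'K].
  have KK := K_nested (ltnW ab) x'K xK.
  have [_ /(_ _ ab)/=] := x'E; have [+ _] := xE.
  move=> /= xl x'l; move: xl; rewrite ltNge => /negP; apply.
  rewrite (_ : B a x = B a x')//; apply: eq_integral => z _.
  by rewrite -KK.
have step2 n y : \sum_(a < n) h a y <= 1.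
  have [[a hy]|no] := pselect (exists a : 'I_n, h a y != 0); last first.
    rewrite big1// => a _; apply/eqP/negP => /negP ha; apply: no.
    by exists a.
  rewrite (bigD1 a)//= big1 ?adde0// => b ba; apply/eqP/negP => /negP hb.
  have : b != a :> nat by [].
  by rewrite neq_ltn => /orP[] lt; [exact: (hu _ _ _ lt hb hy)|exact: (hu _ _ _ lt hy hb)].
have step3 n : \sum_(a < n) lambda%:E * mu (E a) <= \int[mu]_y (g y)%:E.
  apply: (@le_trans _ _ (\sum_(a < n) \int[mu]_y ((g y)%:E * h a y))).
    by apply: lee_sum => a _; exact: step1.
  have mgh a : measurable_fun setT (fun y => (g y)%:E * h a y).
    by apply: emeasurable_funM => //; exact/measurable_EFinP.
  rewrite -ge0_integral_sum//; last first.
    by move=> a y _; rewrite mule_ge0// lee_fin.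
  apply: ge0_le_integral => //.
  - by move=> y _; apply: sume_ge0 => a _; rewrite mule_ge0// lee_fin.
  - exact: emeasurable_sum.
  - exact/measurable_EFinP.
  move=> y _; rewrite -ge0_sume_distrr; last by move=> a _; exact: h0.
  by rewrite -[leRHS]mule1; apply: lee_wpmul2l; rewrite ?lee_fin.
rewrite measure_bigcup//.
rewrite -nneseriesZl//.
apply: lime_le.
  by apply: is_cvg_nneseries => a _ _; rewrite mule_ge0// lee_fin ltW.
near=> n.
rewrite big_mkord (eq_bigl xpredT) => [|a]; last by rewrite in_setT.
exact: step3.
Unshelve. all: by end_near. Qed.

End nested_kernels.

(** * Box majorants in several variables *)

Section box_measure.
Variable R : realType.

(** Releasing one more coordinate gives the disjoint union of the two cylinders on
    which it is prescribed. *)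
Lemma haar_cylinder (N t : nat) (a : nat -> bool) : (t <= N)%N ->
  haar R [set x : walsh_group | forall k, (t <= k < N)%N -> (x : cantor_space) k = a k] =
  (2^-1 ^+ (N - t))%:E.
Proof.
pose S t a := [set x : walsh_group | forall k, (t <= k < N)%N -> (x : cantor_space) k = a k].
have mS u b : measurable (S u b).
  rewrite (_ : S u b = \bigcap_(k in [set k | (u <= k < N)%N])
    ((fun x : walsh_group => (x : cantor_space) k) @^-1` [set b k])); last first.
    by apply/seteqP; split => x xb k kN; exact: xb.
  apply: bigcap_measurableType => k _.
  by rewrite -[X in measurable X]setTI; exact: measurable_coord.
rewrite -/(S t a); elim: t a => [|t IH] a tN.
  rewrite (_ : S 0%N a = dyadic_interval N a).
    by rewrite haar_dyadic_interval prodr_const card_ord subn0.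
  by apply/seteqP; split => x xb k kN; exact: xb.
pose b c := fun k => if k == t then c else a k.
have -> : S t.+1 a = S t (b true) `|` S t (b false).
  apply/seteqP; split => x.
    move=> xa; case xt : ((x : cantor_space) t); [left|right] => k /andP[tk kN];
      rewrite /b; case: eqP => [->//|/eqP kt]; apply: xa; rewrite kN andbT ltn_neqAle eq_sym kt//.
  by move=> [] xb k /andP[tk kN]; rewrite xb ?kN ?(ltnW tk)// /b gtn_eqF.
rewrite measureU//; last first.
  rewrite -subset0 => x [/(_ t) + /(_ t)]; rewrite leqnn tN /b eqxx.
  by move=> /(_ isT) -> /(_ isT).
transitivity ((2^-1 ^+ (N - t))%:E + (2^-1 ^+ (N - t))%:E : \bar R)%E.
  by congr (_ + _)%E; apply: IH; exact: ltnW.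
rewrite -EFinD -(subnSK tN) exprS.
by congr EFin; lra.
Qed.

Lemma haar_dyadic_box (N t p : nat) :
  ((2 ^+ (N - t))%:E * haar R (dyadic_box N t p) = 1)%E.
Proof.
have [tN|Nt] := leqP t N.
  by rewrite /dyadic_box haar_cylinder// -EFinM -exprMn divff// expr1n.
rewrite (_ : dyadic_box N t p = setT) ?probability_setT.
  by rewrite (eqP (ltnW Nt)) expr0 mule1.
by apply/seteqP; split => // x _ k /andP[tk kN]; lia.
Qed.

Lemma integral_product_box D (N t p : 'I_D -> nat) (x : D.-tuple walsh_group) :
  (\int[haar_prod R D]_y
     (product_kernel (fun j => box_kernel R (N j) (t j) (p j)) x y)%:E = 1)%E.
Proof.
pose B j := walsh_translate (tnth x j) @^-1` dyadic_box (N j) (t j) (p j).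
have mB j : measurable (B j).
  rewrite -[X in measurable X]setTI; apply: measurable_walsh_translate => //.
  exact: measurable_dyadic_box.
pose S := [set y : D.-tuple walsh_group | forall j, B j (tnth y j)].
have mS : measurable S.
  rewrite (_ : S = \bigcap_(j in [set: 'I_D]) ((@tnth D walsh_group ^~ j) @^-1` B j)).
    apply: fin_bigcap_measurable => // j _.
    by rewrite -[X in measurable X]setTI; exact: measurable_tnth.
  by apply/seteqP; split => [y yS j _|y yS j]; exact: yS.
transitivity (\int[haar_prod R D]_y ((\prod_j 2 ^+ (N j - t j))%:E * (\1_S y)%:E))%E.
  apply: eq_integral => y _; rewrite -EFinM; congr (_%:E).
  rewrite /product_kernel /box_kernel big_split/=; congr (_ * _).
  have [yS|yS] := pselect (S y).
    rewrite indicE mem_set// big1// => j _; rewrite indicE mem_set//; exact: (yS j).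
  rewrite [RHS]indicE memNset//; apply/eqP/prodf_eq0 => /=.
  have [j yj] : exists j, ~ B j (tnth y j).
    by apply: contrapT => no; apply: yS => j; apply: contrapT => yj; apply: no; exists j.
  by exists j => //; rewrite indicE memNset.
rewrite ge0_integralZl//; [|exact/measurable_EFinP/measurable_indic
  |by rewrite lee_fin; apply: prodr_ge0 => j _; rewrite exprn_ge0].
rewrite integral_indic// setIT.
transitivity ((\prod_j 2 ^+ (N j - t j))%:E * (\prod_j haar R (B j)))%E.
  by congr (_ * _)%E; exact: product_probabilityE.
rewrite -prodEFin -big_split/=.
rewrite big1// => j _; rewrite /B haar_translation_invariant; last exact: measurable_dyadic_box.
exact: haar_dyadic_box.
Qed.

End box_measure.

Section box_majorants.
Variables (R : realType) (D : nat).
Local Notation T := (D.-tuple walsh_group).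
Let mu := haar_prod R D.
Variables (rho : 'I_D -> R) (Mv : nat -> 'I_D -> nat).
Hypothesis rho01 : forall j, 0 < rho j < 1.
Hypothesis Mv_ndecr : forall a a' j, (a' <= a)%N -> (Mv a' j <= Mv a j)%N.
Implicit Types (g : T -> R) (x y : T).
Local Notation index Lam := {ffun 'I_D -> 'I_Lam * 'I_Lam * 'I_Lam}.

Definition majorant (Lam a : nat) : T -> T -> R :=
  product_kernel (fun j => box_majorant (rho j) Lam (Mv a j)).

Definition box_product (Lam : nat) (th : index Lam) (a : nat) : T -> T -> R :=
  product_kernel (fun j => box_kernel R (Mv a j - (th j).1.1) (th j).1.2 (th j).2).

Definition index_weight (Lam : nat) (th : index Lam) : R :=
  \prod_j box_weight (rho j) ((th j).1.1 : nat, (th j).1.2 : nat, (th j).2 : nat).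

Definition weight_bound : R := \prod_j ((1 - rho j)^-1) ^+ 3.

Lemma majorantE Lam a x y :
  majorant Lam a x y = \sum_(th : index Lam) index_weight th ^+ 2 * box_product th a x y.
Proof.
rewrite /majorant /product_kernel /box_majorant bigA_distr_bigA/=.
by apply: eq_bigr => th _; rewrite big_split/= prodrXl.
Qed.

Lemma box_weight_itv j w : 0 < box_weight (rho j) w <= 1.
Proof.
have /andP[r0 r1] := rho01 j.
by rewrite exprn_gt0//= exprn_ile1// ltW.
Qed.

Lemma index_weight_itv Lam (th : index Lam) : 0 < index_weight th <= 1.
Proof.
have w01 j := box_weight_itv j ((th j).1.1 : nat, (th j).1.2 : nat, (th j).2 : nat).
rewrite prodr_gt0 => [|j _]; last by case/andP: (w01 j).
by apply: prodr_ile1 => j; case/andP: (w01 j) => /ltW ->.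
Qed.

Lemma sum_index_weight Lam : \sum_(th : index Lam) index_weight th <= weight_bound.
Proof.
rewrite /index_weight -(bigA_distr_bigA (fun j (w : 'I_Lam * 'I_Lam * 'I_Lam) =>
  box_weight (rho j) (w.1.1 : nat, w.1.2 : nat, w.2 : nat)))/=.
apply: ler_prod => j _; have /andP[r0 r1] := rho01 j; apply/andP; split.
  by apply: sumr_ge0 => w _; case/andP: (box_weight_itv j (w.1.1 : nat, w.1.2 : nat, w.2 : nat)) => /ltW.
pose s := \sum_(i < Lam) rho j ^+ i.
have -> : \sum_(w : 'I_Lam * 'I_Lam * 'I_Lam)
    box_weight (rho j) (w.1.1 : nat, w.1.2 : nat, w.2 : nat) = s ^+ 3.
  rewrite -(pair_bigA _ (fun (w : 'I_Lam * 'I_Lam) (p : 'I_Lam) =>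
    box_weight (rho j) (w.1 : nat, w.2 : nat, p : nat)))/=.
  rewrite -(pair_bigA _ (fun m t : 'I_Lam => \sum_(p < Lam)
    box_weight (rho j) (m : nat, t : nat, p : nat)))/=.
  rewrite !exprS expr0 mulr1 mulr_suml; apply: eq_bigr => m _.
  rewrite mulr_suml mulr_sumr; apply: eq_bigr => t _.
  rewrite !mulr_sumr; apply: eq_bigr => p _.
  by rewrite /box_weight /= !exprD mulrA.
have s0 : 0 <= s by apply: sumr_ge0 => i _; rewrite exprn_ge0// ltW.
apply: lerXn2r => //; first by rewrite nnegrE invr_ge0 subr_ge0 ltW.
rewrite -[leRHS]mul1r ler_pdivlMr ?subr_gt0// mulrC.
have -> : (1 - rho j) * s = 1 - rho j ^+ Lam.
  by rewrite -[RHS]opprB subrX1 -mulNr opprB.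
by rewrite gerBl exprn_ge0// ltW.
Qed.

Lemma weight_bound_gt0 : 0 < weight_bound.
Proof.
by apply: prodr_gt0 => j _; rewrite exprn_gt0// invr_gt0 subr_gt0; case/andP: (rho01 j).
Qed.

Lemma box_product_ge0 Lam (th : index Lam) a x y : 0 <= box_product th a x y.
Proof. by apply: product_kernel_ge0 => j z; exact: box_kernel_ge0. Qed.

Lemma measurable_box_product Lam (th : index Lam) a :
  measurable_fun [set: T * T] (fun xy => box_product th a xy.1 xy.2).
Proof. by apply: measurable_product_kernel => j; exact: measurable_box_kernel. Qed.

Lemma measurable_box_product1 Lam (th : index Lam) a x :
  measurable_fun [set: T] (box_product th a x).
Proof. by apply: measurable_product_kernel1 => j; exact: measurable_box_kernel. Qed.

(** On the coordinates prescribed at the stage [a'], both [x] and [x'] are the sum of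
    [y] and the same unit vectors. *)
Lemma box_product_nested Lam (th : index Lam) a a' x x' y : (a' <= a)%N ->
  box_product th a x y != 0 -> box_product th a' x' y != 0 ->
  forall z, box_product th a' x z = box_product th a' x' z.
Proof.
have inbox b u v : box_product th b u v != 0 -> forall j,
    dyadic_box (Mv b j - (th j).1.1) (th j).1.2 (th j).2 (walsh_translate (tnth u j) (tnth v j)).
  move=> /prodf_neq0 nz j; have := nz j isT.
  rewrite mulf_eq0 negb_or indicE => /andP[_].
  by case: (boolP (_ \in _)) => [/set_mem//|_]; rewrite eqxx.
move=> aa' /inbox xy /inbox x'y z; apply: eq_bigr => j _; rewrite /box_kernel; congr (_ * _).
have xx' k : ((th j).1.2 <= k < Mv a' j - (th j).1.1)%N ->
    (tnth x j : cantor_space) k = (tnth x' j : cantor_space) k.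
  move=> /andP[tk kM]; have := x'y j k; rewrite tk kM => /(_ isT).
  have := xy j k; rewrite tk (leq_trans kM) ?leq_sub2r ?Mv_ndecr// => /(_ isT).
  by rewrite /walsh_translate => <- /addbI.
rewrite !indicE; congr (_%:R); congr nat_of_bool; apply/idP/idP => /set_mem zb; apply/mem_set => k kM;
  by have := zb k kM; rewrite /walsh_translate xx'.
Qed.

Local Open Scope ereal_scope.

Lemma box_product_weak_type Lam (th : index Lam) g (lambda : R) :
  (forall y, 0 <= g y)%R -> measurable_fun [set: T] g -> (0 < lambda)%R ->
  lambda%:E * mu [set x | exists a, lambda%:E < \int[mu]_y (g y * box_product th a x y)%:E]
    <= \int[mu]_y (g y)%:E.
Proof.
move=> g0 mg l0; apply: nested_kernel_weak_type => //.
- by move=> *; exact: box_product_ge0.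
- by move=> a; exact: measurable_box_product.
- move=> a y; rewrite le_eqVlt; apply/orP; left; apply/eqP.
  rewrite -[RHS](integral_product_box R (fun j => (Mv a j - (th j).1.1)%N)
    (fun j => (th j).1.2 : nat) (fun j => (th j).2 : nat) y).
  by apply: eq_integral => x _; rewrite /box_product product_kernelC.
- by move=> *; apply: box_product_nested; eassumption.
Qed.

Lemma majorant_meanE Lam a g x : (forall y, 0 <= g y)%R -> measurable_fun [set: T] g ->
  \int[mu]_y (g y * majorant Lam a x y)%:E =
  \sum_(th : index Lam) (index_weight th ^+ 2)%:E *
    \int[mu]_y (g y * box_product th a x y)%:E.
Proof.
move=> g0 mg.
have m1 (th : index Lam) : measurable_fun [set: T] (fun y => (g y * box_product th a x y)%:E).
  by apply/measurable_EFinP/measurable_funM => //; exact: measurable_box_product1.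
transitivity (\int[mu]_y (\sum_(th : index Lam)
    (index_weight th ^+ 2)%:E * (g y * box_product th a x y)%:E)).
  apply: eq_integral => y _; rewrite majorantE mulr_sumr -sumEFin.
  by apply: eq_bigr => th _; rewrite -EFinM mulrCA.
rewrite ge0_integral_sum//.
- apply: eq_bigr => th _; rewrite ge0_integralZl//; last by rewrite lee_fin sqr_ge0.
  by move=> y _; rewrite lee_fin mulr_ge0// box_product_ge0.
- by move=> th; apply: measurable_funeM.
- by move=> th y _; rewrite -EFinM lee_fin mulr_ge0 ?sqr_ge0// mulr_ge0// box_product_ge0.
Qed.

Lemma majorant_mean_bounded Lam a g x (s : R) : (forall y, 0 <= g y <= s)%R ->
  measurable_fun [set: T] g ->
  \int[mu]_y (g y * majorant Lam a x y)%:E <= (s * weight_bound)%:E.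
Proof.
move=> gs mg; have g0 y : (0 <= g y)%R by have /andP[] := gs y.
have s0 : (0 <= s)%R by have /andP[/le_trans] := gs x; apply.
rewrite majorant_meanE//.
apply: (@le_trans _ _ (\sum_(th : index Lam) (s * index_weight th)%:E)); last first.
  by rewrite sumEFin lee_fin -mulr_sumr ler_wpM2l// sum_index_weight.
apply: lee_sum => th _; have /andP[/ltW w0 w1] := index_weight_itv th.
apply: (@le_trans _ _ ((index_weight th ^+ 2)%:E * s%:E)); last first.
  by rewrite -EFinM lee_fin mulrC ler_wpM2l// expr2 ler_piMl.
apply: lee_wpmul2l; first by rewrite lee_fin sqr_ge0.
have mb : measurable_fun [set: T] (fun y => (box_product th a x y)%:E).
  by apply/measurable_EFinP; exact: measurable_box_product1.
apply: (@le_trans _ _ (\int[mu]_y (s%:E * (box_product th a x y)%:E))).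
  apply: ge0_le_integral => //.
  - by move=> y _; rewrite lee_fin mulr_ge0// box_product_ge0.
  - by apply/measurable_EFinP/measurable_funM => //; exact: measurable_box_product1.
  - exact: measurable_funeM.
  - move=> y _; rewrite -EFinM lee_fin ler_wpM2r ?box_product_ge0//.
    by have /andP[] := gs y.
rewrite ge0_integralZl//; last by move=> y _; rewrite lee_fin box_product_ge0.
by rewrite integral_product_box mule1.
Qed.

Lemma measure_bigsetU_le (I : Type) (s : seq I) (F : I -> set T) :
  (forall i, measurable (F i)) ->
  mu (\big[setU/set0]_(i <- s) F i) <= \sum_(i <- s) mu (F i).
Proof.
move=> mF; elim: s => [|i s IH]; first by rewrite !big_nil measure0.
rewrite !big_cons; apply: le_trans (measureU2 _ _ _) _ => //.
  exact: bigsetU_measurable.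
exact: leeD.
Qed.

(** Some box must carry a share [index_weight th] of the value of the majorant,
    so the level sets for the boxes cover; the square of the weights in the
    majorant leaves one factor to sum their measures. *)
Lemma majorant_weak_type Lam g (lambda : R) :
  (forall y, 0 <= g y)%R -> measurable_fun [set: T] g -> (0 < lambda)%R ->
  lambda%:E * mu [set x | exists a, lambda%:E < \int[mu]_y (g y * majorant Lam a x y)%:E]
    <= (weight_bound ^+ 2)%:E * \int[mu]_y (g y)%:E.
Proof.
move=> g0 mg l0; have W0 := weight_bound_gt0.
pose lth (th : index Lam) := (lambda / (weight_bound * index_weight th))%R.
have w0 (th : index Lam) : (0 < index_weight th)%R by have /andP[] := index_weight_itv th.
have lth0 th : (0 < lth th)%R by rewrite divr_gt0// mulr_gt0.
pose E (th : index Lam) :=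
  [set x | exists a, (lth th)%:E < \int[mu]_y (g y * box_product th a x y)%:E].
have mE th : measurable (E th).
  rewrite (_ : E th = \bigcup_a
    [set x | (lth th)%:E < \int[mu]_y (g y * box_product th a x y)%:E]); last first.
    by apply/seteqP; split => [x [a ?]|x [a _ ?]]; exists a.
  apply: bigcupT_measurable => a; rewrite -[X in measurable X]setTI.
  apply: emeasurable_fun_o_infty => //; apply: measurable_kernel_mean => //.
  - by move=> *; exact: box_product_ge0.
  - exact: measurable_box_product.
have mX : measurable [set x | exists a, lambda%:E < \int[mu]_y (g y * majorant Lam a x y)%:E].
  rewrite (_ : [set x | _] = \bigcup_a
    [set x | lambda%:E < \int[mu]_y (g y * majorant Lam a x y)%:E]); last first.
    by apply/seteqP; split => [x [a ?]|x [a _ ?]]; exists a.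
  apply: bigcupT_measurable => a; rewrite -[X in measurable X]setTI.
  apply: emeasurable_fun_o_infty => //; apply: measurable_kernel_mean => //.
  - move=> x y; rewrite majorantE; apply: sumr_ge0 => th _.
    by rewrite mulr_ge0 ?sqr_ge0// box_product_ge0.
  - rewrite (_ : (fun xy => _) = (fun xy : T * T =>
       \sum_(th : index Lam) index_weight th ^+ 2 * box_product th a xy.1 xy.2)%R).
      by apply: measurable_sum => th; apply: measurable_funM => //; exact: measurable_box_product.
    by apply/funext => xy; rewrite majorantE.
have cover : [set x | exists a, lambda%:E < \int[mu]_y (g y * majorant Lam a x y)%:E]
    `<=` \big[setU/set0]_(th : index Lam) E th.
  move=> x [a xa]; rewrite -bigcup_seq; apply: contrapT => no; move: xa.
  apply/negP; rewrite -leNgt majorant_meanE//.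
  apply: (@le_trans _ _ (\sum_(th : index Lam)
     (lambda / weight_bound * index_weight th)%:E)); last first.
    rewrite sumEFin lee_fin -mulr_sumr -mulrA ler_piMr//; first exact: ltW.
    by rewrite ler_pdivrMl// mulr1 sum_index_weight.
  apply: lee_sum => th _.
  have xth : \int[mu]_y (g y * box_product th a x y)%:E <= (lth th)%:E.
    rewrite leNgt; apply/negP => xth; apply: no; exists th; last by exists a.
    by rewrite /= mem_index_enum.
  apply: (@le_trans _ _ ((index_weight th ^+ 2)%:E * (lth th)%:E)).
    by apply: lee_wpmul2l => //; rewrite lee_fin sqr_ge0.
  rewrite -EFinM lee_fin /lth le_eqVlt; apply/orP; left; apply/eqP.
  by have := w0 th; move=> /lt0r_neq0 ?; have := lt0r_neq0 W0 => ?; field; apply/andP.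
apply: (@le_trans _ _ (lambda%:E * \sum_(th : index Lam) mu (E th))).
  apply: lee_wpmul2l; first by rewrite lee_fin ltW.
  apply: le_trans (measure_bigsetU_le _ mE).
  by apply: le_measure; rewrite ?inE//; exact: bigsetU_measurable.
rewrite ge0_sume_distrr//.
apply: (@le_trans _ _ (\sum_(th : index Lam)
   ((weight_bound * index_weight th)%:E * \int[mu]_y (g y)%:E))).
  apply: lee_sum => th _.
  have -> : lambda%:E = (weight_bound * index_weight th)%:E * (lth th)%:E.
    by rewrite -EFinM /lth mulrC divfK// gt_eqF// mulr_gt0.
  rewrite -muleA; apply: lee_wpmul2l; first by rewrite lee_fin mulr_ge0 ?ltW.
  exact: box_product_weak_type.
have I0 : 0 <= \int[mu]_y (g y)%:E by apply: integral_ge0 => y _; rewrite lee_fin.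
rewrite -ge0_sume_distrl; last by move=> th _; rewrite lee_fin mulr_ge0 ?ltW.
apply: lee_wpmul2r => //.
by rewrite sumEFin lee_fin -mulr_sumr expr2 ler_wpM2l ?sum_index_weight// ltW.
Qed.

End box_majorants.

(** * Levels along the cone *)

Section cone_levels.
Variable R : realType.

Lemma cesaro_number_comparable (a : R) r k m : 0 <= a -> (m <= 2 ^ r * k)%N ->
  cesaro_number a m <= expR a ^+ r * cesaro_number a k.
Proof.
move=> a0 mk; apply: (le_trans (cesaro_number_ndecr a0 mk)).
elim: r {mk} => [|r IH]; first by rewrite mul1n mul1r.
rewrite expnS -mulnA mul2n; apply: (le_trans (cesaro_number_double_le _ a0)).
by rewrite exprS -mulrA ler_wpM2l// expR_ge0.
Qed.

(** The number of binary digits of the integer part. *)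
Definition dyadic_level (u : R) : nat := (trunc_log 2 (Num.truncn u)).+1.

Lemma dyadic_level_ndecr (u v : R) : u <= v -> (dyadic_level u <= dyadic_level v)%N.
Proof. by move=> uv; rewrite ltnS; apply: leq_trunc_log; exact: le_truncn. Qed.

Lemma dyadic_level_gt (u : R) n : n%:R <= u -> (n <= 2 ^ dyadic_level u)%N.
Proof.
move=> nu; apply: (@leq_trans (Num.truncn u)); last exact/ltnW/trunc_log_ltn.
by rewrite truncn_ge_nat// (le_trans _ nu).
Qed.

Lemma dyadic_level_le (u : R) : 1 <= u -> 2 ^+ dyadic_level u <= 2 * u.
Proof.
move=> u1; have u0 : 0 <= u by rewrite (le_trans _ u1).
rewrite /dyadic_level exprS ler_wpM2l//.
apply: (@le_trans _ _ (Num.truncn u)%:R); last by rewrite truncn_le.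
by rewrite -natrX ler_nat trunc_logP// truncn_gt0.
Qed.

Variables (d : nat) (gamma : 'I_d -> R -> R) (beta : 'I_d -> R) (alpha : 'I_d.+1 -> R).
Hypothesis gammaP : cone_restriction_functions gamma.
Hypothesis beta1 : forall j, 1 <= beta j.
Hypothesis alpha0 : forall i, 0 < alpha i.
Let L := cone_like_set gamma beta.

(** The largest value that the cone allows for the coordinate [j] of an index whose
    first coordinate is [a]; the maximum with 1 keeps it monotone down to [a = 0]. *)
Definition cone_bound (a : nat) (j : 'I_d.+1) : R :=
  if unlift ord0 j is Some i then beta i * gamma i (maxn a 1)%:R else (maxn a 1)%:R.

Definition cone_level (a : nat) (j : 'I_d.+1) : nat := dyadic_level (cone_bound a j).

Lemma ler1_maxn (a : nat) : 1 <= (maxn a 1)%:R :> R.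
Proof. by rewrite (ler_nat R 1) leq_maxr. Qed.

Lemma cone_level_ndecr a a' j : (a' <= a)%N -> (cone_level a' j <= cone_level a j)%N.
Proof.
case: gammaP => g1 gi _ _ _; move=> aa'; apply: dyadic_level_ndecr.
rewrite /cone_bound; case: unlift => [i|]; last by rewrite ler_nat; lia.
rewrite ler_wpM2l ?(le_trans _ (beta1 i))//.
have : ((maxn a' 1)%:R : R) <= (maxn a 1)%:R by rewrite ler_nat; lia.
rewrite le_eqVlt => /predU1P[->//|lt]; apply/ltW/gi => //.
- by rewrite in_itv/= ler1_maxn.
- by rewrite in_itv/= ler1_maxn.
Qed.

Lemma cone_bound_ge1 a j : 1 <= cone_bound a j.
Proof.
case: gammaP => g1 _ _ _ _; rewrite /cone_bound; case: unlift => [i|]; last exact: ler1_maxn.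
rewrite (le_trans (beta1 i))// ler_peMr ?g1 ?ler1_maxn//.
by rewrite (le_trans _ (beta1 i)).
Qed.

Lemma cone_le_bound n j : L n -> (n j)%:R <= cone_bound (n ord0) j.
Proof.
move=> [n0 nL]; rewrite /cone_bound (maxn_idPl n0).
by case: unliftP => [i ->|->]//; have /andP[] := nL i.
Qed.

Lemma cone_ge_bound n j : L n -> cone_bound (n ord0) j <=
  (if unlift ord0 j is Some i then beta i ^+ 2 else 1) * (n j)%:R.
Proof.
move=> [n0 nL]; rewrite /cone_bound (maxn_idPl n0).
case: unliftP => [i ->|->]; last by rewrite mul1r.
have b0 : 0 < beta i by rewrite (lt_le_trans _ (beta1 i)).
have /andP[+ _] := nL i; rewrite ler_pdivrMl// => h.
by rewrite expr2 -mulrA ler_wpM2l// ltW.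
Qed.

(** In the cone, [n j] and [2 ^ cone_level (n ord0) j] are comparable, so the kernel
    bound can be written with a level that depends only on the first coordinate. *)
Lemma cone_kernel_bound j : exists C : R, exists rho : R,
  [/\ 0 <= C, 0 < rho < 1 & forall n Lam z, L n -> ((cone_level (n ord0) j).+1 < Lam)%N ->
    `|cesaro_kernel (alpha j) (n j) z| <=
    C * cesaro_number (alpha j) (n j) * box_majorant rho Lam (cone_level (n ord0) j) z].
Proof.
have [C [rho [C0 rho01 CK]]] := cesaro_kernel_bound (alpha0 j).
set b := if unlift ord0 j is Some i then beta i ^+ 2 else 1.
have b0 : 0 <= b by rewrite /b; case: unlift => // i; rewrite sqr_ge0.
pose r := Num.truncn (2 * b); have e0 : 0 < expR (alpha j) by exact: expR_gt0.
exists (C * expR (alpha j) ^+ r.+1), rho; split => //.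
  by rewrite mulr_ge0// exprn_ge0// ltW.
move=> n Lam z nL nLam; set M := cone_level _ _ in nLam *.
have nM : (n j <= 2 ^ M)%N by apply/dyadic_level_gt/cone_le_bound.
apply: (le_trans (CK _ _ _ z nM nLam)).
have m0 : 0 <= box_majorant rho Lam M z.
  by apply: sumr_ge0 => w _; rewrite mulr_ge0 ?box_kernel_ge0// sqr_ge0.
rewrite ler_wpM2r// -mulrA ler_wpM2l//.
apply: cesaro_number_comparable; first exact: ltW.
rewrite -(ler_nat R) natrM !natrX.
apply: (le_trans (dyadic_level_le (cone_bound_ge1 _ _))).
apply: (@le_trans _ _ (2 * (b * (n j)%:R))).
  by rewrite ler_wpM2l// cone_ge_bound.
rewrite mulrA ler_wpM2r//; apply: ltW.
apply: (lt_trans (truncnS_gt _)); rewrite -natrX ltr_nat -/r.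
exact: ltn_expl.
Qed.

End cone_levels.

(** * The distribution of the maximal function *)

Section maximal_cesaro.
Variables (R : realType) (d : nat) (gamma : 'I_d -> R -> R) (beta : 'I_d -> R).
Variable alpha : 'I_d.+1 -> R.
Hypothesis gammaP : cone_restriction_functions gamma.
Hypothesis beta1 : forall j, 1 <= beta j.
Hypothesis alpha0 : forall i, 0 < alpha i.
Local Notation T := (d.+1.-tuple walsh_group).
Let mu := haar_prod R d.+1.
Let L := cone_like_set gamma beta.
Let sigma_star := maximal_cesaro_mean L alpha.
Implicit Types (f : T -> R) (x : T).
Local Open Scope ereal_scope.

Lemma bigcup_index_measurable (P : set ('I_d.+1 -> nat)) (A : ('I_d.+1 -> nat) -> set T) :
  (forall n, measurable (A n)) -> measurable (\bigcup_(n in P) A n).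
Proof.
move=> mA.
rewrite (_ : \bigcup_(n in P) A n =
  \bigcup_(n in [set n : {ffun 'I_d.+1 -> nat} | P n]) A n); last first.
  apply/seteqP; split => [x [n Pn xn]|x [n Pn xn]]; last by exists n.
  have nE : [ffun j => n j] = n :> ('I_d.+1 -> nat) by apply/funext => j; rewrite ffunE.
  by exists [ffun j => n j]; rewrite /= nE.
rewrite bigcup_mkcond; apply: countable_bigcupT_measurable => // n.
by case: ifP.
Qed.

Lemma maximal_cesaro_gtP (lambda : R) f x :
  lambda%:E < sigma_star f x <->
  exists2 n, L n & (lambda < `|cesaro_mean alpha n f x|)%R.
Proof.
split=> [/ereal_sup_gt[_ [n nL <-]]|[n nL ln]].
  by rewrite lte_fin; exists n.
by apply: (@lt_le_trans _ _ `|cesaro_mean alpha n f x|%:E);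
  [rewrite lte_fin|apply: ereal_sup_ubound; exists n].
Qed.

Lemma measurable_cesaro_gt (lambda : R) f n :
  measurable [set x | (lambda < `|cesaro_mean alpha n f x|)%R].
Proof.
rewrite -[X in measurable X]setTI.
have m : measurable_fun setT (fun x => `|cesaro_mean alpha n f x|)%R.
  by apply: measurableT_comp => //; exact: measurable_cesaro_mean.
rewrite (_ : [set x | _] = (fun x => `|cesaro_mean alpha n f x|)%R @^-1` `]lambda, +oo[%classic).
  by apply: m => //; exact: measurable_itv.
by apply/seteqP; split => x /=; rewrite in_itv/= andbT.
Qed.

Lemma measurable_maximal_gt (lambda : R) f : measurable [set x | lambda%:E < sigma_star f x].
Proof.
rewrite (_ : [set x | _] = \bigcup_(n in L)
   [set x | (lambda < `|cesaro_mean alpha n f x|)%R]).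
  by apply: bigcup_index_measurable => n; exact: measurable_cesaro_gt.
by apply/seteqP; split => [x /maximal_cesaro_gtP[n ? ?]|x [n ? ?]];
  [exists n|apply/maximal_cesaro_gtP; exists n].
Qed.

Lemma measurable_maximal f : measurable_fun setT (sigma_star f).
Proof.
apply: (measurability _ (@ErealGenOInfty.measurableE R)) => //.
move=> _ [_ [r ->] <-]; rewrite setTI.
rewrite (_ : _ @^-1` _ = [set x | r%:E < sigma_star f x]).
  exact: measurable_maximal_gt.
by apply/seteqP; split => x /=; rewrite in_itv/= andbT.
Qed.

Lemma maximal_ge0 f x : 0 <= sigma_star f x.
Proof.
apply: (@le_trans _ _ `|cesaro_mean alpha (fun=> 1%N) f x|%:E); first by rewrite lee_fin.
apply: ereal_sup_ubound; exists (fun=> 1%N) => //; split => // j.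
case: gammaP => _ _ _ _ [-> _]; rewrite !mulr1 beta1 andbT.
by rewrite invf_le1// (lt_le_trans _ (beta1 j)).
Qed.

(** The maximal operator is bounded on bounded functions, so the part of [f] below a
    multiple of [lambda] cannot lift the maximal function above [lambda / 2]; the
    weak type estimate is applied to the rest of [f]. This one inequality contains
    the weak type estimate, and by integration in [lambda] the strong ones. *)
Lemma maximal_distribution : exists B : R, exists c : R,
  [/\ (0 <= B)%R, (0 < c)%R & forall f (lambda : R),
    mu.-integrable setT (EFin \o f) -> (0 < lambda)%R ->
    lambda%:E * mu [set x | lambda%:E < sigma_star f x] <=
    B%:E * \int[mu]_y (`|f y| * \1_[set y | (c * lambda < `|f y|)%R] y)%:E].
Proof.
have /choice[Cr CrP] : forall j, exists w : R * R,
    [/\ (0 <= w.1)%R, (0 < w.2 < 1)%R & forall n Lam z, L n ->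
    ((cone_level gamma beta (n ord0) j).+1 < Lam)%N ->
    (`|cesaro_kernel (alpha j) (n j) z| <=
    w.1 * cesaro_number (alpha j) (n j) *
      box_majorant w.2 Lam (cone_level gamma beta (n ord0) j) z)%R].
  move=> j; have [C [rho CP]] := cone_kernel_bound gammaP beta1 alpha0 j.
  by exists (C, rho).
pose rho j := (Cr j).2; pose C j := (Cr j).1.
have rho01 j : (0 < rho j < 1)%R by have [] := CrP j.
have C0 j : (0 <= C j)%R by have [] := CrP j.
pose Mv := cone_level gamma beta.
have Mv_ndecr a a' j : (a' <= a)%N -> (Mv a' j <= Mv a j)%N.
  exact: (cone_level_ndecr gammaP beta1).
pose P := (\prod_j C j + 1)%R; have PC : (0 <= \prod_j C j)%R by apply: prodr_ge0.
have P0 : (0 < P)%R by rewrite ltr_wpDl.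
pose W := weight_bound rho; have W0 : (0 < W)%R := weight_bound_gt0 rho01.
exists (2 * P * W ^+ 2)%R, ((2 * P * W)^-1)%R; split.
- by rewrite !mulr_ge0 ?sqr_ge0// ltW.
- by rewrite invr_gt0 !mulr_gt0.
move=> f lambda intf l0; set c := ((2 * P * W)^-1)%R.
have mf : measurable_fun setT f by apply/measurable_EFinP; exact: measurable_int intf.
have mnf : measurable_fun setT (fun y => `|f y|)%R by exact: measurableT_comp.
pose S := [set y | (c * lambda < `|f y|)%R].
have mS : measurable S.
  rewrite (_ : S = (fun y => `|f y|)%R @^-1` `]c * lambda, +oo[%classic)%R.
    by rewrite -[X in measurable X]setTI; apply: mnf => //; exact: measurable_itv.
  by apply/seteqP; split => x /=; rewrite in_itv/= andbT.
pose g y := (`|f y| * \1_S y)%R; pose h y := (`|f y| * \1_(~` S) y)%R.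
have g0 y : (0 <= g y)%R by rewrite mulr_ge0.
have mg : measurable_fun setT g by apply: measurable_funM => //; exact: measurable_indic.
have mh : measurable_fun setT h.
  by apply: measurable_funM => //; apply: measurable_indic; exact: measurableC.
have h0s y : (0 <= h y <= c * lambda)%R.
  rewrite mulr_ge0//= /h indicE; case: (boolP (y \in ~` S)) => [|_].
    by rewrite inE /S /= mulr1 => /negP; rewrite -leNgt.
  by rewrite mulr0 mulr_ge0 ?(ltW l0)// /c invr_ge0 !mulr_ge0// ltW.
have h0 y : (0 <= h y)%R by have /andP[] := h0s y.
have fgh y : (`|f y| = g y + h y)%R.
  by rewrite /g /h !indicE in_setC; case: (y \in S); rewrite mulr1 mulr0 ?addr0 ?add0r.
pose X Lam := \bigcup_(n in [set n | L n /\ forall j, ((Mv (n ord0) j).+1 < Lam)%N])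
  [set x | (lambda < `|cesaro_mean alpha n f x|)%R].
have mX Lam : measurable (X Lam).
  by apply: bigcup_index_measurable => n; exact: measurable_cesaro_gt.
have XE : [set x | lambda%:E < sigma_star f x] = \bigcup_Lam X Lam.
  apply/seteqP; split => [x /maximal_cesaro_gtP[n nL xn]|x [Lam _ [n [nL _] xn]]].
    exists (\max_j (Mv (n ord0) j).+2)%N => //; exists n => //; split => // j.
    exact: (@leq_bigmax _ (fun j => (Mv (n ord0) j).+2)).
  by apply/maximal_cesaro_gtP; exists n.
have ndX : nondecreasing_seq X.
  move=> a b ab; apply/subsetPset => x [n [nL na] xn]; exists n => //; split => // j.
  exact: leq_trans (na j) ab.
(* half of [lambda] goes to the bounded part of [f], the other half to [g] *)
pose lam' := (lambda / (2 * P))%R.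
have lam'0 : (0 < lam')%R by rewrite divr_gt0// mulr_gt0.
pose Y Lam := [set x | exists a, lam'%:E < \int[mu]_y (g y * majorant rho Mv Lam a x y)%:E].
have mmaj Lam a : measurable_fun [set: T * T] (fun xy => majorant rho Mv Lam a xy.1 xy.2).
  apply: measurable_product_kernel => j.
  by apply: measurable_sum => w; apply: measurable_funM => //; exact: measurable_box_kernel.
have maj0 Lam a x y : (0 <= majorant rho Mv Lam a x y)%R.
  apply: product_kernel_ge0 => j z; apply: sumr_ge0 => w _.
  by rewrite mulr_ge0 ?box_kernel_ge0// sqr_ge0.
have mY Lam : measurable (Y Lam).
  rewrite (_ : Y Lam = \bigcup_a
    [set x | lam'%:E < \int[mu]_y (g y * majorant rho Mv Lam a x y)%:E]); last first.
    by apply/seteqP; split => [x [a ?]|x [a _ ?]]; exists a.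
  apply: bigcupT_measurable => a; rewrite -[X in measurable X]setTI.
  by apply: emeasurable_fun_o_infty => //; exact: measurable_kernel_mean.
have XY Lam : X Lam `<=` Y Lam.
  move=> x [n [nL nLam] xn]; exists (n ord0).
  have A0 j : (0 < cesaro_number (alpha j) (n j))%R.
    by apply: cesaro_number_gt0; rewrite (lt_trans (ltrN10 _)).
  have mb j : measurable_fun setT (box_majorant (rho j) Lam (Mv (n ord0) j)).
    by apply: measurable_sum => w; apply: measurable_funM => //; exact: measurable_box_kernel.
  have b0 j z : (0 <= box_majorant (rho j) Lam (Mv (n ord0) j) z)%R.
    by apply: sumr_ge0 => w _; rewrite mulr_ge0 ?box_kernel_ge0// sqr_ge0.
  have := cesaro_mean_le x intf A0 C0 b0 mb
    (fun j z => let: And3 _ _ H := CrP j in H n Lam z nL (nLam j)).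
  rewrite -/(majorant rho Mv Lam (n ord0)) => le1.
  have m1 (u : T -> R) : measurable_fun setT u ->
      measurable_fun setT (fun y => (u y * majorant rho Mv Lam (n ord0) x y)%:E).
    move=> mu'; apply/measurable_EFinP/measurable_funM => //.
    exact: (measurableT_comp (mmaj Lam (n ord0)) (pair1_measurable x)).
  have split_fgh : \int[mu]_y (`|f y| * majorant rho Mv Lam (n ord0) x y)%:E =
     \int[mu]_y (g y * majorant rho Mv Lam (n ord0) x y)%:E +
     \int[mu]_y (h y * majorant rho Mv Lam (n ord0) x y)%:E.
    rewrite -ge0_integralD//; [|by move=> y _; rewrite lee_fin mulr_ge0|exact: m1
      |by move=> y _; rewrite lee_fin mulr_ge0|exact: m1].
    by apply: eq_integral => y _; rewrite -EFinD -mulrDl -fgh.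
  have hb := @majorant_mean_bounded R d.+1 rho Mv rho01 Lam (n ord0) h x _ h0s mh.
  rewrite ltNge; apply/negP => gl.
  have : (lambda%:E < lambda%:E); last by rewrite ltxx.
  apply: (@lt_le_trans _ _ `|cesaro_mean alpha n f x|%:E); first by rewrite lte_fin.
  apply: (le_trans le1).
  apply: (@le_trans _ _ (P%:E * (lam'%:E + (c * lambda * W)%:E))); last first.
    rewrite -EFinD -EFinM lee_fin le_eqVlt; apply/orP; left; apply/eqP.
    rewrite /lam' /c; have := lt0r_neq0 P0; have := lt0r_neq0 W0 => ? ?.
    by field; apply/andP.
  rewrite split_fgh; apply: (@le_trans _ _ ((\prod_j C j)%:E * (lam'%:E + (c * lambda * W)%:E))).
    by apply: lee_wpmul2l; [rewrite lee_fin|exact: leeD].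
  rewrite -EFinD -!EFinM lee_fin ler_wpM2r ?lerDl// addr_ge0 ?(ltW lam'0)//.
  by rewrite !mulr_ge0 ?(ltW l0) ?(ltW W0)// /c invr_ge0 !mulr_ge0// ltW.
have bound Lam : mu (X Lam) <= (lambda^-1 * (2 * P * W ^+ 2))%:E * \int[mu]_y (g y)%:E.
  apply: (@le_trans _ _ (mu (Y Lam))); first by apply: le_measure; rewrite ?inE.
  have := @majorant_weak_type R d.+1 rho Mv rho01 Mv_ndecr Lam g lam' g0 mg lam'0.
  rewrite -/mu -/(Y Lam) -lee_pdivlMl// => /le_trans; apply.
  rewrite muleA -EFinM le_eqVlt; apply/orP; left; apply/eqP; congr (_%:E * _).
  rewrite /lam' -/W; have := lt0r_neq0 P0; have := lt0r_neq0 l0 => ? ?.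
  by field; apply/andP.
rewrite XE.
have cvgX := @nondecreasing_cvg_mu _ _ _ mu X mX (bigcupT_measurable _ mX) ndX.
have : mu (\bigcup_Lam X Lam) <= (lambda^-1 * (2 * P * W ^+ 2))%:E * \int[mu]_y (g y)%:E.
  rewrite -(cvg_lim _ cvgX)//; apply: lime_le; first by apply: cvgP cvgX.
  by apply: nearW => Lam; exact: bound.
by rewrite EFinM -muleA lee_pdivlMl.
Qed.

End maximal_cesaro.

(** * From the distribution function to norms *)

Section dyadic_levels.
Variable R : realType.
Implicit Types (s v r p q : R) (n k : nat).

(** Truncation at the next level only matters when [r] exceeds the present one, and
    then the last term of the sum is the new bound. *)
Lemma min_powR_le_levels s r p n : 0 < s -> 0 <= r -> 0 < p ->
  Num.min r (s * 2 ^+ n) `^ p <=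
  s `^ p + \sum_(k < n) (s * 2 ^+ k.+1) `^ p * (s * 2 ^+ k < r)%R%:R.
Proof.
move=> s0 r0 p0; have sn k : 0 <= s * 2 ^+ k by rewrite mulr_ge0 ?exprn_ge0 ?ltW.
elim: n => [|n IH].
  rewrite big_ord0 addr0 expr0 mulr1 ge0_ler_powR ?nnegrE ?(ltW p0) ?(ltW s0)//.
    by rewrite le_min r0 ltW.
  by rewrite ge_min lexx orbT.
rewrite big_ord_recr/= addrA; case: ltP => nr.
  rewrite mulr1; apply: (@le_trans _ _ ((s * 2 ^+ n.+1) `^ p)).
    rewrite ge0_ler_powR ?nnegrE ?(ltW p0)//; first by rewrite le_min r0 sn.
    by rewrite ge_min lexx orbT.
  rewrite lerDr addr_ge0 ?powR_ge0//; apply: sumr_ge0 => k _.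
  by rewrite mulr_ge0 ?powR_ge0.
rewrite mulr0 addr0; apply: le_trans IH.
rewrite (min_idPl nr) (min_idPl _)//; apply: (le_trans nr).
by rewrite ler_pM2l// ler_eXn2l// ltr1n.
Qed.

Lemma powR2_gt1 q : 0 < q -> 1 < 2 `^ q.
Proof.
move=> q0; have := @gt0_ltr_powR R q q0 1 2; rewrite powR1; apply.
- by rewrite nnegrE.
- by rewrite nnegrE.
- by rewrite ltr1n.
Qed.

(** A geometric sum is comparable to its last term, here at a level below [2 * v]. *)
Lemma sum_levels_le s v q n : 0 < s -> 0 <= v -> 0 < q ->
  \sum_(k < n) (s * 2 ^+ k.+1) `^ q * (s * 2 ^+ k < v)%R%:R <=
  2 `^ q / (2 `^ q - 1) * (2 * v) `^ q.
Proof.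
move=> s0 v0 q0; have sn k : 0 <= s * 2 ^+ k by rewrite mulr_ge0 ?exprn_ge0 ?ltW.
set a := 2 `^ q; set G := a / (a - 1).
have a1 : 1 < a by exact: powR2_gt1.
have G0 : 0 <= G by rewrite divr_ge0 ?powR_ge0// subr_ge0 ltW.
have sS k : (s * 2 ^+ k.+1) `^ q = (s * 2 ^+ k) `^ q * a.
  by rewrite exprSr mulrA powRM// ltW.
have F m : \sum_(k < m) (s * 2 ^+ k.+1) `^ q * (s * 2 ^+ k < v)%R%:R <= G * (s * 2 ^+ m) `^ q.
  elim: m => [|m IH]; first by rewrite big_ord0 mulr_ge0 ?powR_ge0.
  rewrite big_ord_recr/=; apply: (@le_trans _ _ (G * (s * 2 ^+ m) `^ q + (s * 2 ^+ m.+1) `^ q)).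
    by rewrite lerD// ler_piMr ?powR_ge0//; case: ltP.
  rewrite sS le_eqVlt; apply/orP; left; apply/eqP; rewrite /G.
  by field; rewrite subr_eq0 gt_eqF.
elim: n => [|n IH]; first by rewrite big_ord0 mulr_ge0 ?powR_ge0.
case: (ltP (s * 2 ^+ n) v) => nv.
  apply: (le_trans (F n.+1)); rewrite ler_wpM2l// ge0_ler_powR ?nnegrE ?(ltW q0)//.
    by rewrite mulr_ge0.
  by rewrite exprS mulrCA ler_wpM2l// ltW.
by rewrite big_ord_recr/= ltNge nv/= mulr0 addr0.
Qed.

Lemma exists_level s r : 0 < s -> exists n, r <= s * 2 ^+ n.
Proof.
move=> s0; exists (Num.truncn (r / s)).+1; rewrite -ler_pdivrMl// mulrC.
apply: (le_trans (ltW (truncnS_gt _))); rewrite -natrX ler_nat.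
exact/ltnW/ltn_expl.
Qed.

Local Open Scope ereal_scope.

Lemma poweR_le_levels s p (y : \bar R) : (0 < s)%R -> (0 < p)%R -> 0 <= y ->
  y `^ p <= (s `^ p)%:E +
    \sum_(0 <= k <oo) ((s * 2 ^+ k.+1) `^ p)%:E * (if (s * 2 ^+ k)%:E < y then 1 else 0).
Proof.
move=> s0 p0 y0.
pose t k := ((s * 2 ^+ k.+1) `^ p)%:E * (if (s * 2 ^+ k)%:E < y then 1 else 0) : \bar R.
have t0 k : 0 <= t k by rewrite mule_ge0 ?lee_fin ?powR_ge0//; case: ifP.
rewrite -/(\sum_(0 <= k <oo) t k).
have part n : \sum_(k < n) t k <= \sum_(0 <= k <oo) t k.
  by rewrite -(big_mkord xpredT t); apply: nneseries_lim_ge.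
case: y y0 @t t0 part => [r|_|//]; last first.
  move=> t t0 part; rewrite poweRyr ?gt_eqF// leye_eq; apply/eqP/eq_infty => r.
  have s1 : (0 < s `^ p)%R by exact: powR_gt0.
  have [n rn] : exists n, (r <= n%:R * s `^ p)%R.
    exists (Num.truncn (r / s `^ p)).+1; rewrite -ler_pdivrMr//.
    exact/ltW/truncnS_gt.
  apply: (@le_trans _ _ (\sum_(k < n) t k)); last first.
    by apply: (le_trans (part n)); rewrite leeDr// lee_fin powR_ge0.
  apply: (@le_trans _ _ (\sum_(k < n) (s `^ p)%:E)).
    by rewrite sumEFin lee_fin sumr_const card_ord -mulr_natl.
  apply: lee_sum => k _; rewrite /t ltry mule1 lee_fin.
  rewrite ge0_ler_powR ?nnegrE ?(ltW p0) ?(ltW s0)//.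
    by rewrite mulr_ge0 ?exprn_ge0 ?ltW.
  by rewrite ler_peMr ?(ltW s0)// exprn_ege1// ler1n.
rewrite lee_fin => r0 t t0 part.
have [n rn] := exists_level r s0.
have := min_powR_le_levels n s0 r0 p0; rewrite (min_idPl rn) => le1.
rewrite poweR_EFin; apply: (@le_trans _ _ ((s `^ p)%:E + \sum_(k < n) t k)).
  rewrite (_ : \sum_(k < n) t k = (\sum_(k < n) (s * 2 ^+ k.+1) `^ p * (s * 2 ^+ k < r)%R%:R)%:E).
    by rewrite -EFinD lee_fin.
  rewrite -sumEFin; apply: eq_bigr => k _; rewrite /t lte_fin EFinM.
  by case: ltP.
by rewrite leeD2l.
Qed.

End dyadic_levels.

Section distribution_to_norm.
Context d (T : measurableType d) (R : realType) (mu : probability T R).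
Variables (B c : R) (f : T -> R) (u : T -> \bar R).
Hypotheses (B0 : 0 <= B) (c0 : 0 < c).
Hypotheses (mf : measurable_fun setT f) (mu_u : measurable_fun setT u).
Local Open Scope ereal_scope.
Hypothesis u0 : forall x, 0 <= u x.
Hypothesis distr : forall lambda : R, (0 < lambda)%R ->
  lambda%:E * mu [set x | lambda%:E < u x] <=
  B%:E * \int[mu]_y (`|f y| * \1_[set y | (c * lambda < `|f y|)%R] y)%:E.

Let mnf : measurable_fun setT (fun y => `|f y|)%R.
Proof. exact: measurableT_comp. Qed.

Let mS (l : R) : measurable [set y | (l < `|f y|)%R].
Proof.
rewrite (_ : [set y | _] = (fun y => `|f y|)%R @^-1` `]l, +oo[%classic).
  by rewrite -[X in measurable X]setTI; apply: mnf => //; exact: measurable_itv.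
by apply/seteqP; split => x /=; rewrite in_itv/= andbT.
Qed.

Let mE (l : R) : measurable [set x | l%:E < u x].
Proof. by rewrite -[X in measurable X]setTI; exact: emeasurable_fun_o_infty. Qed.

Lemma distribution_weak_norm :
  ereal_sup [set lambda%:E * mu [set x | lambda%:E < u x]
            | lambda in [set lambda : R | (0 < lambda)%R]]
    <= B%:E * 'N[mu]_1[EFin \o f].
Proof.
apply: ge_ereal_sup => _ [l l0 <-]; apply: (le_trans (distr l0)).
rewrite Lnorm1; apply: lee_wpmul2l; first by rewrite lee_fin.
apply: ge0_le_integral => //.
- by apply/measurable_EFinP/measurable_funM => //; exact: measurable_indic.
- exact/measurable_EFinP.
- by move=> y _; rewrite lee_fin ler_piMr// indicE; case: (_ \in _).
Qed.

(** When [c * lambda] exceeds the essential supremum of [f], the right-hand side of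
    the distributional inequality vanishes. *)
Lemma distribution_Linfty : 'N[mu]_+oo[u] <= (c^-1)%:E * 'N[mu]_+oo[EFin \o f].
Proof.
rewrite unlock /Lnorm /= probability_setT lte01.
set s := ess_sup mu (abse \o (EFin \o f)).
have s0 : 0 <= s.
  have mu1 : 0 < mu [set: T] by rewrite probability_setT lte01.
  by apply: (ess_sup_gee mu1); apply: nearW => x /=; rewrite lee_fin.
have [->|sfin] := eqVneq s +oo; first by rewrite gt0_muley ?leey// lte_fin invr_gt0.
have {sfin} sf : s \is a fin_num by rewrite ge0_fin_numE// ltey.
apply/lee_addgt0Pr => e e0.
pose l := (c^-1 * fine s + e)%R.
have l0 : (0 < l)%R by rewrite ltr_wpDl// mulr_ge0 ?invr_ge0 ?fine_ge0// ltW.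
have -> : (c^-1)%:E * s + e%:E = l%:E by rewrite -[in LHS](fineK sf).
have z : \int[mu]_y (`|f y| * \1_[set y | (c * l < `|f y|)%R] y)%:E = 0.
  rewrite (ae_eq_integral (cst 0)) ?integral0//.
    by apply/measurable_EFinP/measurable_funM => //; exact: measurable_indic.
  have := ess_sup_ge mu (abse \o (EFin \o f)); rewrite -/s.
  apply: filterS => y /= fs _; rewrite indicE memNset ?mulr0//= => lf.
  have : (`|f y|%:E < `|f y|%:E); last by rewrite ltxx.
  apply: (le_lt_trans fs); rewrite -[ltLHS](fineK sf) lte_fin; apply: lt_trans lf.
  by rewrite /l mulrDr mulrA divff ?gt_eqF// mul1r ltrDl mulr_gt0.
apply/ess_supP/ae_le_measureP; first exact: measurableT_comp.
have := distr l0; rewrite z mule0 => h.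
rewrite (_ : _ @^-1` _ = [set x | l%:E < u x]).
  apply/eqP; rewrite eq_le measure_ge0 andbT.
  by rewrite -(@lee_pmul2l _ l%:E) ?lte_fin// mule0.
by apply/seteqP; split => x /=; rewrite in_itv/= andbT gee0_abs.
Qed.

(** Marcinkiewicz interpolation against the trivial bound for bounded functions, with
    the integral over the levels replaced by a sum over the levels [s * 2 ^ k]. The
    levels below [s] cost at most [s `^ p] because the measure is a probability. *)
Lemma distribution_Lp p (s : R) : (1 < p)%R -> (0 < s)%R ->
  \int[mu]_x (`|u x| `^ p) <= (s `^ p)%:E +
    (2 * B * (2 `^ (p - 1) / (2 `^ (p - 1) - 1)) * (2 / c) `^ (p - 1))%:E *
      \int[mu]_x (`|f x| `^ p)%:E.
Proof.
move=> p1 s0; have p0 : (0 < p)%R by rewrite (lt_trans _ p1).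
have q0 : (0 < p - 1)%R by rewrite subr_gt0.
set G := (2 `^ (p - 1) / (2 `^ (p - 1) - 1))%R.
have G0 : (0 <= G)%R by rewrite divr_ge0 ?powR_ge0// subr_ge0 ltW ?powR2_gt1.
pose l k := (s * 2 ^+ k)%R.
have l0 k : (0 < l k)%R by rewrite mulr_gt0// exprn_gt0.
pose E k := [set x | (l k)%:E < u x].
pose t k := (l k.+1 `^ p)%R; have t0 k : (0 <= t k)%R by exact: powR_ge0.
have mtE k : measurable_fun setT (fun x => (t k)%:E * (\1_(E k) x)%:E).
  apply: measurable_funeM; apply/measurable_EFinP/measurable_indic; exact: mE.
have tE0 k x : 0 <= (t k)%:E * (\1_(E k) x)%:E by rewrite -EFinM lee_fin mulr_ge0.
apply: (@le_trans _ _ (\int[mu]_x ((s `^ p)%:E + \sum_(0 <= k <oo) (t k)%:E * (\1_(E k) x)%:E))).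
  apply: ge0_le_integral => //.
  - by move=> x _; exact: poweR_ge0.
  - apply: (measurableT_comp (measurable_poweR _)); exact: measurableT_comp.
  - by apply: emeasurable_funD => //; exact: ge0_emeasurable_sum.
  - move=> x _; rewrite gee0_abs//; apply: (le_trans (poweR_le_levels s0 p0 (u0 x))).
    rewrite leeD2l// le_eqVlt; apply/orP; left; apply/eqP; apply: eq_eseriesr => k _.
    by rewrite indicE; congr (_ * _); case: ifPn => uk; [rewrite mem_set|rewrite memNset//; exact/negP].
rewrite ge0_integralD//; first last.
- exact: ge0_emeasurable_sum.
- by move=> x _; apply: nneseries_ge0.
- by move=> x _; rewrite lee_fin powR_ge0.
have -> : \int[mu]_x (s `^ p)%:E = (s `^ p)%:E.
  rewrite integral_cst// -[RHS]mule1; congr (_ * _); exact: probability_setT.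
rewrite leeD2l//.
rewrite integral_nneseries//.
pose S k := [set y | (c * l k < `|f y|)%R].
have mfS k : measurable_fun setT (fun y => (`|f y| * \1_(S k) y)%:E).
  by apply/measurable_EFinP/measurable_funM => //; apply: measurable_indic; exact: mS.
have fS0 k y : 0 <= (`|f y| * \1_(S k) y)%:E by rewrite lee_fin mulr_ge0.
pose w k := (t k / l k * B)%R.
have w0 k : (0 <= w k)%R by rewrite mulr_ge0// divr_ge0// ltW.
have wf0 k y : 0 <= (w k)%:E * (`|f y| * \1_(S k) y)%:E.
  by rewrite mule_ge0// lee_fin.
apply: (@le_trans _ _ (\sum_(0 <= k <oo) \int[mu]_y ((w k)%:E * (`|f y| * \1_(S k) y)%:E))).
  apply: lee_nneseries => [k _ _|k _]; first exact: integral_ge0.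
  rewrite ge0_integralZl//; [|by apply/measurable_EFinP; apply: measurable_indic; exact: mE
    |by rewrite lee_fin].
  rewrite integral_indic; [|by []|exact: mE]; rewrite setIT ge0_integralZl//; last by rewrite lee_fin.
  rewrite /w EFinM -muleA [(t k / l k)%:E]EFinM -muleA.
  apply: lee_wpmul2l; first by rewrite lee_fin.
  by rewrite lee_pdivlMl// distr.
apply: (@le_trans _ _ (\int[mu]_y \sum_(0 <= k <oo) (w k)%:E * (`|f y| * \1_(S k) y)%:E)).
  rewrite le_eqVlt; apply/orP; left; apply/eqP; symmetry; apply: integral_nneseries => //.
  by move=> k; exact: measurable_funeM.
rewrite -ge0_integralZl; first last.
- by rewrite lee_fin mulr_ge0 ?powR_ge0// mulr_ge0// mulr_ge0.
- by move=> x _; rewrite lee_fin powR_ge0.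
- apply/measurable_EFinP; exact: (measurableT_comp (measurable_powR p) mnf).
- by [].
apply: ge0_le_integral => //.
- by move=> y _; apply: nneseries_ge0 => k _ _; exact: wf0.
- by apply: ge0_emeasurable_sum => [k y _ _|k _]; [exact: wf0|exact: measurable_funeM].
- apply: measurable_funeM; apply/measurable_EFinP.
  exact: (measurableT_comp (measurable_powR p) mnf).
move=> y _; apply: lime_le.
  by apply: is_cvg_nneseries => k _ _; exact: wf0.
apply: nearW => n; rewrite big_mkord.
pose v := (`|f y| / c)%R; have v0 : (0 <= v)%R by rewrite divr_ge0// ltW.
rewrite (_ : \sum_(k < n) (w k)%:E * (`|f y| * \1_(S k) y)%:E =
  (2 * B * `|f y| * \sum_(k < n) (s * 2 ^+ k.+1) `^ (p - 1) * (s * 2 ^+ k < v)%R%:R)%:E).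
  rewrite -EFinM lee_fin.
  apply: (@le_trans _ _ (2 * B * `|f y| * (G * (2 * v) `^ (p - 1)))%R).
    by rewrite ler_wpM2l ?sum_levels_le// !mulr_ge0.
  have -> : (2 * v = 2 / c * `|f y|)%R by rewrite /v; ring.
  rewrite powRM// ?divr_ge0// ?(ltW c0)// -(mulr_powRB1 (normr_ge0 _) p0).
  by rewrite le_eqVlt; apply/orP; left; apply/eqP; ring.
rewrite mulr_sumr -sumEFin; apply: eq_bigr => k _; rewrite -EFinM; congr (_%:E).
rewrite /w /t -(mulr_powRB1 (ltW (l0 k.+1)) p0).
have -> : (\1_(S k) y = (s * 2 ^+ k < v)%R%:R :> R)%R.
  rewrite indicE; congr (_%:R); congr nat_of_bool.
  by apply/idP/idP; rewrite inE /S /= /v ltr_pdivlMr// mulrC.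
have lS : (l k.+1 = 2 * l k)%R by rewrite /l exprS; ring.
rewrite -/(l k.+1) {1}lS; have := lt0r_neq0 (l0 k) => ?.
by field.
Qed.

Lemma distribution_Lp_norm p : (1 < p)%R -> 'N[mu]_p%:E[EFin \o f] < +oo ->
  'N[mu]_p%:E[u] <= ((1 + 2 * B * (2 `^ (p - 1) / (2 `^ (p - 1) - 1)) *
    (2 / c) `^ (p - 1)) `^ p^-1)%:E * 'N[mu]_p%:E[EFin \o f].
Proof.
move=> p1 foo; have p0 : (0 < p)%R by rewrite (lt_trans _ p1).
have q0 : (0 < p - 1)%R by rewrite subr_gt0.
set K := (2 * B * _ * _)%R.
have K0 : (0 <= K)%R.
  rewrite mulr_ge0 ?powR_ge0// mulr_ge0//; first by rewrite mulr_ge0.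
  by rewrite divr_ge0 ?powR_ge0// subr_ge0 ltW ?powR2_gt1.
set C := ((1 + K) `^ p^-1)%R; have C0 : (0 < C)%R by rewrite powR_gt0// ltr_wpDr.
have Nfin : 'N[mu]_p%:E[EFin \o f] \is a fin_num by rewrite ge0_fin_numE ?Lnorm_ge0.
set N := fine 'N[mu]_p%:E[EFin \o f].
have N0 : (0 <= N)%R by rewrite fine_ge0 ?Lnorm_ge0.
have NE : 'N[mu]_p%:E[EFin \o f] = N%:E by rewrite /N fineK.
rewrite NE; apply/lee_addgt0Pr => e e0.
pose s := (N + e / C)%R; have s0 : (0 < s)%R by rewrite ltr_wpDl// divr_gt0.
have fE : \int[mu]_x (`|f x| `^ p)%:E = (N `^ p)%:E.
  by rewrite -poweR_EFin -NE powR_Lnorm ?gt_eqF.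
have := distribution_Lp p1 s0; rewrite -/K fE -EFinM -EFinD => le1.
have le2 : \int[mu]_x (`|u x| `^ p) <= ((1 + K) * s `^ p)%:E.
  apply: (le_trans le1); rewrite lee_fin mulrDl mul1r lerD2l ler_wpM2l//.
  by rewrite ge0_ler_powR ?nnegrE ?(ltW p0) ?(ltW s0)// lerDl divr_ge0// ltW.
have -> : C%:E * N%:E + e%:E = (((1 + K) * s `^ p)%:E `^ p^-1).
  rewrite poweR_EFin powRM ?powR_ge0 ?addr_ge0// -powRrM mulfV ?gt_eqF// powRr1 ?(ltW s0)//.
  by rewrite -/C -EFinM -EFinD /s mulrDr mulrCA mulfV ?gt_eqF// mulr1.
rewrite unlock /Lnorm gt0_ler_poweR//.
- by rewrite invr_ge0 ltW.
- by rewrite in_itv/= leey andbT; apply: integral_ge0 => x _; exact: poweR_ge0.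
- by rewrite in_itv/= leey andbT lee_fin mulr_ge0 ?powR_ge0// addr_ge0.
Qed.

End distribution_to_norm.

(** * Boundedness of the maximal operator *)

Theorem mainTheorem2 (R : realType) (d : nat) (gamma : 'I_d -> R -> R)
    (beta : 'I_d -> R) (alpha : 'I_d.+1 -> R) :
  (2 <= d.+1)%N ->
  cone_restriction_functions gamma ->
  (forall j, 1 <= beta j) ->
  (forall i, 0 < alpha i) ->
  let mu := haar_prod R d.+1 in
  let sigma_star := maximal_cesaro_mean (cone_like_set gamma beta) alpha in
  (forall p : \bar R, (1 < p)%E ->
    exists C : R, forall f : d.+1.-tuple walsh_group -> R, f \in Lfun mu p ->
      ('N[mu]_p[sigma_star f] <= C%:E * 'N[mu]_p[EFin \o f])%E) /\
  (exists C : R, forall f : d.+1.-tuple walsh_group -> R, f \in Lfun mu 1%E ->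
    (ereal_sup [set lambda%:E * mu [set x | lambda%:E < sigma_star f x]
               | lambda in [set lambda : R | (0 < lambda)%R]]
      <= C%:E * 'N[mu]_1[EFin \o f])%E).
Proof.
move=> _ gammaP beta1 alpha0 mu sigma_star.
have [B [c [B0 c0 distr]]] := maximal_distribution gammaP beta1 alpha0.
have mu_star f : measurable_fun setT (sigma_star f) by exact: measurable_maximal.
have star0 f x : (0 <= sigma_star f x)%E by exact: maximal_ge0.
have mfun_Lfun p f : f \in Lfun mu p -> measurable_fun setT f.
  by rewrite inE => /andP[]; rewrite inE.
split; last first.
  exists B => f fL; apply: (@distribution_weak_norm _ _ _ mu B c) => //.
    exact: mfun_Lfun fL.
  by move=> l l0; apply: distr => //; exact/Lfun1_integrable.
have intf p f : (1 < p)%E -> f \in Lfun mu p -> mu.-integrable setT (EFin \o f).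
  move=> /ltW p1 fL; apply/Lfun1_integrable; apply: (Lfun_subset _ p1 _ p1 fL) => //.
  exact: fin_num_measure.
case=> [p| |//]; last first.
  move=> p1; exists c^-1 => f fL; apply: (@distribution_Linfty _ _ _ mu B c) => //.
    exact: mfun_Lfun fL.
  by move=> l l0; apply: distr => //; exact: intf fL.
move=> p1; exists ((1 + 2 * B * (2 `^ (p - 1) / (2 `^ (p - 1) - 1)) *
    (2 / c) `^ (p - 1)) `^ p^-1) => f fL.
apply: (@distribution_Lp_norm _ _ _ mu B c) => //.
- exact: mfun_Lfun fL.
- by move=> l l0; apply: distr => //; exact: intf fL.
- by move: fL; rewrite inE => /andP[_]; rewrite inE.
Qed.
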